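(* Let $x_1=w_1\varepsilon^{\mu_1}$, $x_2=w_2\varepsilon^{\mu_2}\in\widetilde W$. Choose $(v_1,v_2)\in\mathrm{LP}(x_1)\times\mathrm{LP}(x_2)$ such that $d(v_1\Rightarrow w_2v_2)$ is minimal among all such pairs. Then $$x_1\ast x_2=w_1v_1v_2^{-1}\varepsilon^{v_2v_1^{-1}\mu_1+\mu_2-v_2\,\mathrm{wt}(v_1\Rightarrow w_2v_2)},$$ $\ell(x_1\ast x_2)=\ell(x_1)+\ell(x_2)-d(v_1\Rightarrow w_2v_2)$, and $v_2\in\mathrm{LP}(x_1\ast x_2)$.
   Context: Let $\Phi$ be a reduced crystallographic finite root system with fixed basis $\Delta$, positive roots $\Phi^+$, negative roots $\Phi^-=-\Phi^+$, Weyl group $W$ and $2\rho=\sum_{\beta\in\Phi^+}\beta$. For $\alpha\in\Phi$, $\alpha^\vee$ is its coroot and $s_\alpha$ its reflection; $\ell$ on $W$ is the Coxeter length. Let $X_*$ be an abelian group containing $\mathbb Z\Phi^\vee$, with a bilinear pairing $\langle\cdot,\cdot\rangle:X_*\times\mathbb Z\Phi\to\mathbb Z$ extending the coroot–root pairing; $W$ acts by $s_\alpha(\mu)=\mu-\langle\mu,\alpha\rangle\alpha^\vee$. $\Phi^+(\alpha)=1$ if $\alpha\in\Phi^+$, $0$ otherwise. $\widetilde W=W\ltimes X_*$ with elements $w\varepsilon^\mu$, $\varepsilon^\mu w=w\varepsilon^{w^{-1}\mu}$. Affine roots $\Phi\times\mathbb Z$ with action $(w\varepsilon^\mu)(\alpha,k)=(w\alpha,k-\langle\mu,\alpha\rangle)$;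 positive affine roots $\{(\alpha,k):k\ge\Phi^+(-\alpha)\}$; $\ell(x)$ is the number of positive affine roots $a$ with $xa$ not positive; $r_{(\alpha,k)}=s_\alpha\varepsilon^{k\alpha^\vee}$. Bruhat order: generated by $x<xr_a$ whenever $\ell(x)<\ell(xr_a)$. Demazure product: for $x_1,x_2\in\widetilde W$, the set $\{x_1'x_2':x_1'\le x_1,x_2'\le x_2\}$ has a unique Bruhat-maximal element, denoted $x_1\ast x_2$. $\ell(x,\alpha)=\langle\mu,\alpha\rangle+\Phi^+(\alpha)-\Phi^+(w\alpha)$ for $x=w\varepsilon^\mu$; $\mathrm{LP}(x)=\{v\in W:\ell(x,v\alpha)\ge0\ \forall\alpha\in\Phi^+\}$. $\mathrm{QB}(W)$: vertex set $W$, edge $u\to us_\alpha$ ($\alpha\in\Phi^+$) if $\ell(us_\alpha)=\ell(u)+1$ (weight $0$) or $\ell(us_\alpha)=\ell(u)+1-\langle\alpha^\vee,2\rho\rangle$ (weight $\alpha^\vee$); $d(u\Rightarrow u')$ is the shortest path length and all shortest paths have a common weight $\mathrm{wt}(u\Rightarrow u')$. *)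

(* Defs.v *)
From HB Require Import structures.
From mathcomp Require Import all_boot all_order all_algebra all_fingroup.
From Stdlib Require Import ClassicalEpsilon Relation_Operators.
Set Implicit Arguments. Unset Strict Implicit. Unset Printing Implicit Defensive.
Import Order.TTheory GRing.Theory Num.Theory.
Local Open Scope ring_scope.

Definition decP (P : Prop) : bool :=
  if excluded_middle_informative P then true else false.

(* A reduced crystallographic finite root system Phi = {rd_rt i | i : 'I_N}
   in V = 'rV[rat]_rk with basis Delta = {rd_rt i | rd_simp i}, an abelian
   group X = X_* with coroots rd_cor i = (rd_rt i)^vee in X, and the pairing
   <mu, alpha> : X x Z.Phi -> Z, given by its (integer) values on roots
   rd_pair mu i = <mu, rd_rt i>, biadditive (extends to Z.Phi). *)
Record rootDatum := RootDatum {
  rd_rk : nat;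
  rd_N : nat;
  rd_rt : 'I_rd_N -> 'rV[rat]_rd_rk;
  rd_simp : pred 'I_rd_N;
  rd_X : zmodType;
  rd_pair : rd_X -> 'I_rd_N -> int;
  rd_cor : 'I_rd_N -> rd_X;
  rd_rt_inj : injective rd_rt;
  rd_rt_neq0 : forall i, rd_rt i != 0;
  rd_reduced : forall i j (c : rat), rd_rt j = c *: rd_rt i -> c = 1 \/ c = -1;
  rd_pair_cor : forall i, rd_pair (rd_cor i) i = 2;
  rd_refl_stable : forall i j, exists k,
      rd_rt k = rd_rt j - (rd_pair (rd_cor i) j)%:~R *: rd_rt i;
  rd_pairD : forall mu nu j, rd_pair (mu + nu) j = rd_pair mu j + rd_pair nu j;
  (* ... and is (the restriction to Phi of) an additive map on Z.Phi *)
  rd_pair_lin : forall mu (z : 'I_rd_N -> int),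
      \sum_i (z i)%:~R *: rd_rt i = 0 -> \sum_i z i * rd_pair mu i = 0;
  (* the subgroup of X generated by the coroots is the coroot lattice Z.Phi^vee
     (it embeds into Hom(Z.Phi, Z)) *)
  rd_corlat : forall z : 'I_rd_N -> int,
      (forall j, rd_pair (\sum_i rd_cor i *~ z i) j = 0) ->
      \sum_i rd_cor i *~ z i = 0;
  rd_simp_free : forall a : 'I_rd_N -> rat, (forall i, ~~ rd_simp i -> a i = 0) ->
      \sum_i a i *: rd_rt i = 0 -> forall i, a i = 0;
  rd_simp_span : forall j, exists z : 'I_rd_N -> int,
      (forall i, ~~ rd_simp i -> z i = 0) /\
      rd_rt j = \sum_i (z i)%:~R *: rd_rt i /\
      ((forall i, 0 <= z i) \/ (forall i, z i <= 0))
}.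

Section Defs.
Variable D : rootDatum.
Local Notation N := (@rd_N D).
Local Notation rt := (@rd_rt D).
Local Notation simp := (@rd_simp D).
Local Notation X := (@rd_X D).
Local Notation pair := (@rd_pair D).
Local Notation cor := (@rd_cor D).

Definition posv (v : 'rV[rat]_(rd_rk D)) : bool :=
  decP ((exists j, rt j = v) /\
        exists z : 'I_N -> nat, (forall i, ~~ simp i -> z i = 0%N) /\
                                v = \sum_i (z i)%:R *: rt i).
Definition PhiP (v : 'rV[rat]_(rd_rk D)) : int := (posv v : nat)%:Z.
Definition pos (j : 'I_N) : bool := posv (rt j).

(* The Weyl group W, realised as a permutation group of the root indices:
   w \in W is the permutation p with  w(rt j) = rt (p^-1 j)  (so that the
   group law of {perm _} is the group law of W). *)
Definition reflf (i j : 'I_N) : 'I_N :=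
  odflt j [pick k | rt k == rt j - (pair (cor i) j)%:~R *: rt i].
Definition refl (i : 'I_N) : {perm 'I_N} := insubd (1%g : {perm 'I_N}) [ffun j => reflf i j].
Definition Wgrp : {group {perm 'I_N}} := <<[set refl i | i : 'I_N]>>%G.
Definition wact (w : {perm 'I_N}) (j : 'I_N) : 'I_N := (w^-1)%g j.
Definition prodw (s : seq 'I_N) : {perm 'I_N} := (\prod_(i <- s) refl i)%g.

(* action of W on X: s_alpha(mu) = mu - <mu,alpha> alpha^vee, extended along
   any word in the reflections representing w *)
Definition reflX (i : 'I_N) (mu : X) : X := mu - cor i *~ pair mu i.
Definition wordOf (w : {perm 'I_N}) : seq 'I_N :=
  epsilon (inhabits [::]) (fun s => prodw s = w).
Definition wactX (w : {perm 'I_N}) (mu : X) : X := foldr reflX mu (wordOf w).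

Definition coxlen (w : {perm 'I_N}) : nat :=
  epsilon (inhabits 0%N) (fun k =>
    (exists s, size s = k /\ all simp s /\ prodw s = w) /\
    forall s, all simp s -> prodw s = w -> (k <= size s)%N).

(* Extended affine Weyl group: (w, mu) stands for w eps^mu, w \in W *)
Definition Wt := ({perm 'I_N} * X)%type.
Definition mulWt (x y : Wt) : Wt := ((x.1 * y.1)%g, wactX (y.1^-1)%g x.2 + y.2).
Definition raff (j : 'I_N) (k : int) : Wt := (refl j, cor j *~ k).

(* number of integers k with lo <= k < hi *)
Definition nb_int (lo hi : int) : nat := absz (Num.max 0 (hi - lo)).
(* l(x) = #{positive affine roots a = (alpha,k) with x a not positive}:
   a positive iff k >= Phi^+(-alpha); x a = (w alpha, k - <mu,alpha>). *)
Definition lenA (x : Wt) : nat :=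
  \sum_(j : 'I_N) nb_int (PhiP (- rt j))
                         (pair x.2 j + PhiP (- rt (wact x.1 j))).

Definition bru_step (x y : Wt) : Prop :=
  exists j k, y = mulWt x (raff j k) /\ (lenA x < lenA y)%N.
Definition bru : Wt -> Wt -> Prop := clos_refl_trans Wt bru_step.

Definition is_demazure (x1 x2 y : Wt) : Prop :=
  (exists x1' x2', bru x1' x1 /\ bru x2' x2 /\ y = mulWt x1' x2') /\
  (forall x1' x2', bru x1' x1 -> bru x2' x2 -> bru (mulWt x1' x2') y).

Definition ell_aff (x : Wt) (b : 'I_N) : int :=
  pair x.2 b + PhiP (rt b) - PhiP (rt (wact x.1 b)).
Definition LP (x : Wt) (v : {perm 'I_N}) : Prop :=
  v \in Wgrp /\ forall i, pos i -> 0 <= ell_aff x (wact v i).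

Definition two_rho (j : 'I_N) : int := \sum_(i | pos i) pair (cor j) i.
Definition qb_edge (u u' : {perm 'I_N}) : Prop :=
  exists j, pos j /\ u' = (u * refl j)%g /\
    (coxlen u' = (coxlen u).+1 \/
     (coxlen u')%:Z = (coxlen u)%:Z + 1 - two_rho j).
Definition qb_wt (u u' : {perm 'I_N}) : X :=
  epsilon (inhabits 0) (fun mu => exists j, pos j /\ u' = (u * refl j)%g /\
    ((coxlen u' = (coxlen u).+1 /\ mu = 0) \/
     ((coxlen u')%:Z = (coxlen u)%:Z + 1 - two_rho j /\ mu = cor j))).
Fixpoint qb_path (u : {perm 'I_N}) (p : seq {perm 'I_N}) (u' : {perm 'I_N})
  : Prop :=
  match p with
  | [::] => u = u'
  | v :: p' => qb_edge u v /\ qb_path v p' u'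
  end.
Fixpoint pwt (u : {perm 'I_N}) (p : seq {perm 'I_N}) : X :=
  match p with
  | [::] => 0
  | v :: p' => qb_wt u v + pwt v p'
  end.
Definition dQB (u u' : {perm 'I_N}) : nat :=
  epsilon (inhabits 0%N) (fun k =>
    (exists p, qb_path u p u' /\ size p = k) /\
    forall p, qb_path u p u' -> (k <= size p)%N).
Definition wtQB (u u' : {perm 'I_N}) : X :=
  pwt u (epsilon (inhabits [::]) (fun p => qb_path u p u' /\ size p = dQB u u')).

End Defs.

(* Main.v *)
Require Import Defs.
From HB Require Import structures.
From mathcomp Require Import all_boot all_order all_algebra all_fingroup zify ring.
From Stdlib Require Import ClassicalEpsilon Relation_Operators.
Set Implicit Arguments. Unset Strict Implicit. Unset Printing Implicit Defensive.
Import Order.TTheory GRing.Theory Num.Theory.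
Local Open Scope ring_scope.

(** The length of [x = w eps^mu] is the maximum over [v] in [W] of
    [Lsum x v = sum_(b > 0) ell(x, v b)], and [LP x] is the set of maximisers;
    since [Lsum (x y) v = Lsum x (w_y v) + Lsum y v], lengths add in [x y]
    exactly when [w_y v] lies in [LP x] for some [v] in [LP y].  Put
    [delta u a = l(u s_a) - l(u) + <a^vee, 2 rho> [u a < 0]], so that
    [delta >= 1], with equality exactly on the edges of the quantum Bruhat
    graph.  If [x r_a] covers [x] and [v] is in [LP x], the change of [Lsum]
    is so constrained that [v], or [v s_b] with an edge [v s_b -> v], is in
    [LP (x r_a)].  Bruhat intervals contain saturated chains, hence for
    [x' <= x1] every element of [LP x'] is reached from [LP x1] by a path of
    length at most [l(x1) - l(x')].  Conversely a shortest path from [v1] to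
    [w2 v2] is followed by a descending chain of covers from [x1] to some [z]
    with [l(z) = l(x1) - d] and [w2 v2] in [LP z].  The product [z x2] is length
    additive and is the claimed element.  As the Demazure product has the form
    [x' x2] with [x' <= x1] and additive lengths, the first half bounds its
    length by [l(x1) + l(x2) - d = l(z x2)], so that it equals [z x2]. *)

Section RootDatum.
Variable D : rootDatum.
Local Notation N := (@rd_N D).
Local Notation rt := (@rd_rt D).
Local Notation simp := (@rd_simp D).
Local Notation X := (@rd_X D).
Local Notation pair := (@rd_pair D).
Local Notation cor := (@rd_cor D).
Local Notation W := (Wgrp D).

(** * Reflections and the action of W on X *)

Implicit Types (i j k : 'I_N) (mu nu : X) (w u v : {perm 'I_N}).

Lemma decPP (P : Prop) : reflect P (Defs.decP P).
Proof. by rewrite /Defs.decP; case: excluded_middle_informative => h; constructor. Qed.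

(** These are the restrictions to [Phi] of additive maps on the root lattice, expressed through the
    integer relations that they respect. *)
Definition lin (f : 'I_N -> int) := forall z : 'I_N -> int,
  \sum_i (z i)%:~R *: rt i = 0 -> \sum_i z i * f i = 0.

Lemma lin_pair mu : lin (pair mu).
Proof. exact: rd_pair_lin. Qed.

Lemma sum_delta (V : zmodType) (F : 'I_N -> V) i : \sum_l F l *+ (l == i) = F i.
Proof.
by rewrite (bigD1 i) //= eqxx mulr1n big1 ?addr0 // => l /negPf ->; rewrite mulr0n.
Qed.

(** The coefficients are added up as multiples of indicator functions, so the three indices may
    coincide. *)
Lemma lin_rel3 (f : 'I_N -> int) (p q r : int) i j k : lin f ->
  p%:~R *: rt i + q%:~R *: rt j + r%:~R *: rt k = 0 ->
  p * f i + q * f j + r * f k = 0.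
Proof.
move=> hf hz.
have := hf (fun l => p *+ (l == i) + q *+ (l == j) + r *+ (l == k)).
under eq_bigr => l _ do
  rewrite !rmorphD /= !rmorphMn /= !scalerDl -!scalerMnl.
rewrite !big_split /= !sum_delta => /(_ hz).
under eq_bigr => l _ do rewrite !mulrDl !mulrnAl.
by rewrite !big_split /= !sum_delta.
Qed.

Lemma pair0 j : pair 0 j = 0.
Proof. by move: (rd_pairD (0 : X) 0 j); rewrite addr0; lia. Qed.

Lemma pairN mu j : pair (- mu) j = - pair mu j.
Proof. by move: (rd_pairD mu (- mu) j); rewrite subrr pair0; lia. Qed.

Lemma pairMz mu (n : int) j : pair (mu *~ n) j = n * pair mu j.
Proof.
have hn (m : nat) : pair (mu *+ m) j = m%:Z * pair mu j.
  elim: m => [|m IH]; first by rewrite mulr0n pair0 mul0r.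
  by rewrite mulrS rd_pairD IH intS mulrDl mul1r.
by case: n => n; rewrite ?NegzE ?mulrNz ?pairN -pmulrn hn ?mulNr.
Qed.

Lemma rt_reflf i j : rt (reflf i j) = rt j - (pair (cor i) j)%:~R *: rt i.
Proof.
rewrite /reflf; case: pickP => [k /eqP //|h].
by have [k hk] := rd_refl_stable i j; move: (h k); rewrite hk eqxx.
Qed.

Lemma lin_reflf (f : 'I_N -> int) i j : lin f ->
  f (reflf i j) = f j - pair (cor i) j * f i.
Proof.
move=> hf; have := @lin_rel3 f 1 (-1) (pair (cor i) j) (reflf i j) j i hf.
rewrite rt_reflf scale1r scaleN1r => H.
suff /H : rt j - (pair (cor i) j)%:~R *: rt i - rt j + (pair (cor i) j)%:~R *: rt i = 0 by lia.
by rewrite addrAC subrK subrr.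
Qed.

Lemma pair_reflf mu i j : pair mu (reflf i j) = pair mu j - pair (cor i) j * pair mu i.
Proof. exact: lin_reflf (lin_pair mu). Qed.

Lemma pair_cor_reflf i j : pair (cor i) (reflf i j) = - pair (cor i) j.
Proof. by rewrite pair_reflf rd_pair_cor; lia. Qed.

Lemma reflfK i : involutive (reflf i).
Proof.
move=> j; apply: rd_rt_inj; rewrite !rt_reflf pair_cor_reflf.
by rewrite mulrNz scaleNr opprK subrK.
Qed.

Lemma reflE i j : refl i j = reflf i j.
Proof.
(* [refl] falls back on the identity when the function is not injective; [reflfK] excludes this. *)
have hi : [ffun j => reflf i j] \in [pred f : {ffun 'I_N -> 'I_N} | injectiveb f].
  rewrite inE; apply/injectiveP => a b; rewrite !ffunE; exact: (can_inj (reflfK i)).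
by rewrite -pvalE /refl insubdK // ffunE.
Qed.

Lemma refl2 i : (refl i * refl i = 1)%g.
Proof. by apply/permP => j; rewrite permM !reflE reflfK perm1. Qed.

Lemma reflV i : ((refl i)^-1 = refl i)%g.
Proof. by apply/eqP; rewrite eq_invg_mul refl2. Qed.

Lemma wact_refl i j : wact (refl i) j = reflf i j.
Proof. by rewrite /wact reflV reflE. Qed.

Lemma wactM u v j : wact (u * v)%g j = wact u (wact v j).
Proof. by rewrite /wact invMg permM. Qed.

Lemma wact1 j : wact 1%g j = j.
Proof. by rewrite /wact invg1 perm1. Qed.

Lemma wactK u : cancel (wact u) (wact u^-1%g).
Proof. by move=> j; rewrite -wactM mulVg wact1. Qed.

Lemma wactKV u : cancel (wact u^-1%g) (wact u).
Proof. by move=> j; rewrite -wactM mulgV wact1. Qed.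

Lemma wact_inj u : injective (wact u).
Proof. exact: can_inj (wactK u). Qed.

Lemma wact_ext u v : (forall j, wact u j = wact v j) -> u = v.
Proof. by move=> h; apply: invg_inj; apply/permP => j; apply: h. Qed.

Lemma refl_W i : refl i \in W.
Proof. by apply: mem_gen; apply: imset_f. Qed.

Lemma prodw_cons i s : prodw (i :: s) = (refl i * prodw s)%g.
Proof. by rewrite /prodw big_cons. Qed.

Lemma prodw_cat (s t : seq 'I_N) : prodw (s ++ t) = (prodw s * prodw t)%g.
Proof. by rewrite /prodw big_cat. Qed.

Lemma prodw_rcons s i : prodw (rcons s i) = (prodw s * refl i)%g.
Proof. by rewrite -cats1 prodw_cat /prodw big_seq1. Qed.

Lemma prodw_W s : prodw s \in W.
Proof.
elim: s => [|i s IH]; first by rewrite /prodw big_nil group1.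
by rewrite prodw_cons groupM ?refl_W.
Qed.

Lemma W_word w : w \in W -> exists s, prodw s = w.
Proof.
case/gen_prodgP => n [c hc ->].
have {}hc (k : 'I_n) : exists i, c k = refl i by case/imsetP: (hc k) => i _ ->; exists i.
have [f hf] := fin_all_exists hc; exists (map f (index_enum 'I_n)).
by rewrite /prodw big_map; apply: eq_bigr.
Qed.

Lemma W_ind (P : {perm 'I_N} -> Prop) :
  P 1%g -> (forall i w, w \in W -> P w -> P (refl i * w)%g) -> forall w, w \in W -> P w.
Proof.
move=> P1 PM w /W_word [s <-]; elim: s => [|i s IH]; first by rewrite /prodw big_nil.
by rewrite prodw_cons; apply: PM => //; apply: prodw_W.
Qed.

Lemma lin_wact f w : w \in W -> lin f -> lin (f \o wact w).
Proof.
move=> wW hf; elim/W_ind: wW f hf => [|i w0 _ IH] f hf.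
  by move=> z /hf; under [in X in _ -> X]eq_bigr => j _ do rewrite /= wact1.
have h : lin (f \o reflf i).
  move=> z hz /=; under eq_bigr => j _ do rewrite lin_reflf // mulrBr mulrA.
  by rewrite sumrB hf // -mulr_suml lin_pair // mul0r subr0.
by move=> z /(IH _ h); under [in X in _ -> X]eq_bigr => j _ do rewrite /= wactM wact_refl.
Qed.

Lemma pair_reflX i mu j : pair (reflX i mu) (reflf i j) = pair mu j.
Proof.
by rewrite /reflX rd_pairD pairN pairMz pair_cor_reflf pair_reflf; lia.
Qed.

Lemma pair_foldr s mu j : pair (foldr (@reflX D) mu s) (wact (prodw s) j) = pair mu j.
Proof.
elim: s => [|i s IH] /=; first by rewrite /prodw big_nil wact1.
by rewrite prodw_cons wactM wact_refl pair_reflX.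
Qed.

Lemma foldr_lat s mu : exists z : 'I_N -> int,
  foldr (@reflX D) mu s = mu + \sum_i cor i *~ z i.
Proof.
elim: s => [|i s [z hz]] /=.
  by exists (fun=> 0); rewrite big1 ?addr0.
exists (fun l => z l - pair (foldr (@reflX D) mu s) i *+ (l == i)).
under eq_bigr => l _ do rewrite mulrzBr -[_ *+ _]mulr_natr natz mulrzA -pmulrn.
by rewrite sumrB sum_delta /reflX {1}hz addrA.
Qed.

(** By [foldr_lat] the two results differ by an element of the coroot lattice. It pairs to zero with
    every root, so [rd_corlat] makes it vanish; hence [wactX] does not depend on the word chosen. *)
Lemma foldr_prodw s t mu : prodw s = prodw t ->
  foldr (@reflX D) mu s = foldr (@reflX D) mu t.
Proof.
move=> e; have [z hz] := foldr_lat s mu; have [y hy] := foldr_lat t mu.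
have eB : \sum_i cor i *~ (z i - y i)
    = foldr (@reflX D) mu s - foldr (@reflX D) mu t.
  by under eq_bigr => i _ do rewrite mulrzBr; rewrite sumrB hz hy opprD addrACA subrr add0r.
apply/subr0_eq; rewrite -eB; apply: rd_corlat => j; rewrite eB rd_pairD pairN.
by rewrite -(wactKV (prodw s) j) pair_foldr {2}e pair_foldr subrr.
Qed.

Lemma wactX_prodw s mu : wactX (prodw s) mu = foldr (@reflX D) mu s.
Proof.
apply: foldr_prodw; rewrite /wordOf.
by apply: (epsilon_spec (inhabits [::]) (fun t => prodw t = prodw s)); exists s.
Qed.

Lemma wactX_refl i mu : wactX (refl i) mu = reflX i mu.
Proof. by have := wactX_prodw [:: i] mu; rewrite /prodw big_seq1. Qed.

Lemma wactX1 mu : wactX 1%g mu = mu.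
Proof. by have := wactX_prodw [::] mu; rewrite /prodw big_nil. Qed.

Lemma wactXM u v mu : u \in W -> v \in W -> wactX (u * v)%g mu = wactX u (wactX v mu).
Proof.
move=> /W_word [s <-] /W_word [t <-].
by rewrite -prodw_cat !wactX_prodw foldr_cat.
Qed.

Lemma wactXK u mu : u \in W -> wactX u^-1%g (wactX u mu) = mu.
Proof. by move=> uW; rewrite -wactXM ?groupV // mulVg wactX1. Qed.

Lemma wactXKV u mu : u \in W -> wactX u (wactX u^-1%g mu) = mu.
Proof. by move=> uW; rewrite -wactXM ?groupV // mulgV wactX1. Qed.

Lemma pair_wactX w mu j : w \in W -> pair (wactX w mu) (wact w j) = pair mu j.
Proof. by move=> /W_word [s <-]; rewrite wactX_prodw pair_foldr. Qed.

Lemma pair_wactXV w mu j : w \in W -> pair (wactX w^-1%g mu) j = pair mu (wact w j).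
Proof.
by move=> wW; rewrite -[in LHS](wactK w j) pair_wactX ?groupV.
Qed.

Lemma reflXD i : {morph @reflX D i : mu nu / mu + nu}.
Proof. by move=> mu nu; rewrite /reflX rd_pairD mulrzDr opprD addrACA. Qed.

Lemma wactXD w : w \in W -> {morph @wactX D w : mu nu / mu + nu}.
Proof.
move=> /W_word [s <-] mu nu; rewrite !wactX_prodw.
by elim: s => //= i s ->; rewrite reflXD.
Qed.

Lemma wactX0 w : w \in W -> @wactX D w 0 = 0.
Proof. by move=> wW; apply: (addrI (wactX w 0)); rewrite -wactXD // !addr0. Qed.

Lemma wactXN w mu : w \in W -> wactX w (- mu) = - wactX w mu.
Proof. by move=> wW; apply: (addrI (wactX w mu)); rewrite -wactXD // !subrr wactX0. Qed.

Lemma wactXMz w mu (n : int) : w \in W -> wactX w (mu *~ n) = wactX w mu *~ n.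
Proof.
move=> wW; have hn (m : nat) : wactX w (mu *+ m) = wactX w mu *+ m.
  by elim: m => [|m IH]; rewrite ?mulr0n ?wactX0 // !mulrS wactXD ?IH.
by case: n => n; rewrite ?NegzE ?mulrNz -!pmulrn ?wactXN ?hn.
Qed.

(* Opaque copies of [refl] and [reflf]: unification otherwise unfolds these
   down to rational arithmetic. *)
Lemma srefl_subproof : {f : 'I_N -> {perm 'I_N} | f =1 @refl D}.
Proof. by exists (@refl D). Qed.

Definition srefl i : {perm 'I_N} := sval srefl_subproof i.

Lemma sact_subproof : {f : 'I_N -> 'I_N -> 'I_N | forall i j, f i j = reflf i j}.
Proof. by exists (@reflf D). Qed.

Definition sact i j : 'I_N := sval sact_subproof i j.

Lemma sreflE i : srefl i = refl i.
Proof. exact: svalP srefl_subproof i. Qed.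

Lemma sactE i j : sact i j = reflf i j.
Proof. exact: svalP sact_subproof i j. Qed.

Lemma rt_sact i j : rt (sact i j) = rt j - (pair (cor i) j)%:~R *: rt i.
Proof. by rewrite sactE rt_reflf. Qed.

Lemma lin_sact (f : 'I_N -> int) i j : lin f ->
  f (sact i j) = f j - pair (cor i) j * f i.
Proof. by rewrite sactE; apply: lin_reflf. Qed.

Lemma pair_sact mu i j : pair mu (sact i j) = pair mu j - pair (cor i) j * pair mu i.
Proof. by rewrite sactE pair_reflf. Qed.

Lemma pair_cor_sact i j : pair (cor i) (sact i j) = - pair (cor i) j.
Proof. by rewrite sactE pair_cor_reflf. Qed.

Lemma sactK i : involutive (sact i).
Proof. by move=> j; rewrite [sact i j]sactE sactE reflfK. Qed.

Lemma wact_srefl i j : wact (srefl i) j = sact i j.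
Proof. by rewrite sreflE wact_refl sactE. Qed.

Lemma srefl2 i : (srefl i * srefl i = 1)%g.
Proof. by rewrite sreflE refl2. Qed.

Lemma sreflV i : ((srefl i)^-1 = srefl i)%g.
Proof. by rewrite sreflE reflV. Qed.

Lemma srefl_W i : srefl i \in W.
Proof. by rewrite sreflE refl_W. Qed.

Lemma W_ind_srefl (P : {perm 'I_N} -> Prop) :
  P 1%g -> (forall i w, w \in W -> P w -> P (srefl i * w)%g) -> forall w, w \in W -> P w.
Proof. by move=> P1 PM; apply: W_ind => // i w; rewrite -sreflE; apply: PM. Qed.

Lemma pair_reflX_sact i mu j : pair (reflX i mu) (sact i j) = pair mu j.
Proof. by rewrite sactE pair_reflX. Qed.

Lemma wactX_srefl i mu : wactX (srefl i) mu = reflX i mu.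
Proof. by rewrite sreflE wactX_refl. Qed.

(** Otherwise repeated translation by [d] would produce [N + 1] distinct roots. This finiteness
    argument is what excludes unipotent motions below. *)
Lemma no_arith_prog (d : 'rV[rat]_(rd_rk D)) (Q : 'I_N -> Prop) :
  d != 0 -> (forall j, Q j -> exists2 k, Q k & rt k = rt j + d) -> forall j, ~ Q j.
Proof.
move=> d0 hQ j0 hj0.
have hp (p : nat) : exists2 k, Q k & rt k = rt j0 + p%:R *: d.
  elim: p => [|p [k hk e]]; first by exists j0 => //; rewrite scale0r addr0.
  have [l hl el] := hQ k hk; exists l => //.
  by rewrite el e -addrA -natr1 scalerDl scale1r.
have hq (p : 'I_N.+1) : exists k, rt k = rt j0 + (val p)%:R *: d by have [k _] := hp p; exists k.
have [g hg] := fin_all_exists hq.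
have gi : injective g.
  move=> p q e; apply/val_inj/eqP; rewrite -(eqr_nat rat) -subr_eq0.
  have : ((val p)%:R - (val q)%:R) *: d = 0.
    by apply/eqP; rewrite scalerBl subr_eq0 -(inj_eq (addrI (rt j0))) -!hg e.
  by move/eqP; rewrite scaler_eq0 (negPf d0) orbF.
by have := leq_card g gi; rewrite !card_ord ltnn.
Qed.

Lemma neg_subproof i : {j | rt j = - rt i}.
Proof.
exists (sact i i); rewrite rt_sact rd_pair_cor.
by apply/rowP => c; rewrite !mxE; ring.
Qed.

Definition neg i : 'I_N := sval (neg_subproof i).

Lemma rt_neg i : rt (neg i) = - rt i.
Proof. exact: svalP (neg_subproof i). Qed.

Lemma sact_id i : sact i i = neg i.
Proof.
by apply: rd_rt_inj; rewrite rt_sact rt_neg rd_pair_cor; apply/rowP => c; rewrite !mxE; ring.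
Qed.

Lemma lin_neg (f : 'I_N -> int) i : lin f -> f (neg i) = - f i.
Proof. by move=> hf; rewrite -sact_id lin_sact // rd_pair_cor; lia. Qed.

Lemma pair_neg mu i : pair mu (neg i) = - pair mu i.
Proof. exact: (lin_neg i (lin_pair mu)). Qed.

Lemma negK : involutive neg.
Proof. by move=> i; apply: rd_rt_inj; rewrite !rt_neg opprK. Qed.

Lemma wact_neg w i : w \in W -> wact w (neg i) = neg (wact w i).
Proof.
move=> wW; elim/W_ind_srefl: wW i => [|l u _ IH] i; first by rewrite !wact1.
rewrite !wactM IH !wact_srefl; apply: rd_rt_inj.
by rewrite rt_sact rt_neg [in RHS]rt_neg rt_sact pair_neg; apply/rowP => c; rewrite !mxE; ring.
Qed.

(** A linear [f] vanishing at the root [s_l i] is invariant under the reflection in that root, and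
    also under [s_l s_i s_l], which moves vectors along the same root. *)
Lemma lin_conj_sact (f : 'I_N -> int) l i p : lin f -> f (sact l i) = 0 ->
  f (sact (sact l i) (sact l (sact i (sact l p)))) = f p.
Proof.
move=> lf fk; rewrite (lin_sact (sact l i) _ lf) fk mulr0 subr0.
have -> : f (sact l (sact i (sact l p))) =
    f p - pair (cor i) (sact l p) * (f i - pair (cor l) i * f l).
  rewrite (lin_sact l _ lf) (lin_sact i _ lf) (lin_sact l p lf).
  by rewrite [pair (cor l) (sact i _)]pair_sact pair_cor_sact; ring.
by rewrite -(lin_sact l i lf) fk mulr0 subr0.
Qed.

(* Two reflections with the same root differ by a unipotent map, which has
   finite order only if it is trivial. *)
Lemma pair_cor_conj l i j : pair (cor (sact l i)) (sact l j) = pair (cor i) j.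
Proof.
set k := sact l i.
pose f m := pair (cor i) (sact l m) - pair (cor k) m.
have lf : lin f.
  have h := lin_wact (srefl_W l) (lin_pair (cor i)).
  move=> z hz; rewrite /f; under eq_bigr => m _ do rewrite mulrBr.
  rewrite sumrB (lin_pair (cor k) hz) subr0 -[RHS](h z hz).
  by apply: eq_bigr => m _; rewrite /= wact_srefl.
have fk : f k = 0 by rewrite /f /k sactK !rd_pair_cor subrr.
suff f0 m : f m = 0.
  by move: (f0 (sact l j)); rewrite /f sactK; lia.
apply/eqP; case: (eqVneq (f m) 0) => // fm.
(* The product of the two reflections preserves [f] and moves a root [p] by [f p] times [rt k]; a
   nonzero value would yield an endless arithmetic progression. *)
case: (@no_arith_prog ((f m)%:~R *: rt k) (fun p => f p = f m) _ _ m) => //.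
  by rewrite scaler_eq0 intr_eq0 (negPf fm) (negPf (rd_rt_neq0 k)).
move=> p hp; exists (sact k (sact l (sact i (sact l p)))).
  by rewrite -hp; exact: lin_conj_sact.
pose a := pair (cor i) (sact l p).
have e : rt (sact l (sact i (sact l p))) = rt p - a%:~R *: rt k.
  rewrite rt_sact pair_sact -/a rt_sact [rt (sact l p)]rt_sact pair_cor_sact -/a.
  by rewrite /k rt_sact; apply/rowP => c; rewrite !mxE; ring.
have ek : pair (cor k) (sact l (sact i (sact l p))) = pair (cor k) p - a * 2.
  have := @lin_rel3 _ 1 (-1) a (sact l (sact i (sact l p))) p k (lin_pair (cor k)).
  rewrite e rd_pair_cor => h.
  suff /h : 1 *: (rt p - a%:~R *: rt k) + (-1)%:~R *: rt p + a%:~R *: rt k = 0 by lia.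
  by apply/rowP => c; rewrite !mxE; ring.
rewrite rt_sact e ek -hp /f -/a.
by apply/rowP => c; rewrite !mxE; ring.
Qed.

(** * The invariant form *)

(** The difference of the two sides is the coroot combination with coefficients [z], and it pairs to
    zero with every root by [pair_cor_conj]. *)
Lemma cor_sact l i : cor (sact l i) = reflX l (cor i).
Proof.
pose z m : int := (m == sact l i)%:Z - (m == i)%:Z + pair (cor i) l *+ (m == l).
have e : \sum_m cor m *~ z m = cor (sact l i) - reflX l (cor i).
  rewrite /z /reflX; under eq_bigr => m _ do
    rewrite mulrzDr mulrzBr -!pmulrn -[pair _ _ *+ _]mulr_natr natz mulrzA -pmulrn.
  by rewrite big_split /= sumrB !sum_delta opprB addrA addrAC.
apply/subr0_eq; rewrite -e; apply: rd_corlat => j; rewrite e rd_pairD pairN.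
by rewrite -[j](sactK l) pair_cor_conj pair_reflX_sact subrr.
Qed.

Lemma sact_conj l i j : sact l (sact i j) = sact (sact l i) (sact l j).
Proof.
apply: rd_rt_inj; rewrite !rt_sact pair_cor_conj pair_sact.
by apply/rowP => c; rewrite !mxE; ring.
Qed.

Lemma wact_sact w i j : w \in W -> wact w (sact i j) = sact (wact w i) (wact w j).
Proof.
move=> wW; elim/W_ind_srefl: wW => [|l u _ IH]; first by rewrite !wact1.
by rewrite !wactM IH !wact_srefl sact_conj.
Qed.

Lemma srefl_wact w i : w \in W -> (srefl (wact w i) * w = w * srefl i)%g.
Proof.
by move=> wW; apply: wact_ext => j; rewrite 2!wactM !wact_srefl wact_sact.
Qed.

Lemma cor_wact w i : w \in W -> cor (wact w i) = wactX w (cor i).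
Proof.
move=> wW; elim/W_ind_srefl: (wW) => [|l u uW IH]; first by rewrite wact1 wactX1.
by rewrite wactM wact_srefl cor_sact IH wactXM ?srefl_W // wactX_srefl.
Qed.

Lemma cor_neg i : cor (neg i) = - cor i.
Proof.
rewrite -sact_id cor_sact /reflX rd_pair_cor -pmulrn mulr2n.
by rewrite opprD addrA subrr add0r.
Qed.

Lemma srefl_neg i : srefl (neg i) = srefl i.
Proof.
apply: wact_ext => j; rewrite !wact_srefl; apply: rd_rt_inj.
rewrite !rt_sact cor_neg pairN rt_neg.
by apply/rowP => c; rewrite !mxE; ring.
Qed.

(** The standard W-invariant form, obtained by summing over all coroots. It supplies the inner
    product that the root datum does not carry. *)
Definition invform i j : int := \sum_l pair (cor l) i * pair (cor l) j.

Lemma invformC i j : invform i j = invform j i.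
Proof. by apply: eq_bigr => l _; rewrite mulrC. Qed.

Lemma invform_sact l i j : invform (sact l i) (sact l j) = invform i j.
Proof.
rewrite /invform (reindex_inj (can_inj (sactK l))).
by apply: eq_bigr => m _; rewrite !pair_cor_conj.
Qed.

Lemma lin_invform i : lin (invform i).
Proof.
move=> z hz; rewrite /invform; under eq_bigr => j _ do rewrite mulr_sumr.
rewrite exchange_big big1 // => l _.
under eq_bigr => j _ do rewrite mulrCA.
by rewrite -mulr_sumr (lin_pair _ hz) mulr0.
Qed.

(** Invariance under the reflection in [i] itself, which sends [i] to its negative. *)
Lemma invform_pair i j : 2 * invform i j = pair (cor i) j * invform i i.
Proof.
have := invform_sact i i j; rewrite sact_id invformC (lin_neg _ (lin_invform _)).
by rewrite invformC (lin_sact _ _ (lin_invform _)); lia.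
Qed.

Lemma invform_gt0 i : 0 < invform i i.
Proof.
rewrite /invform (bigD1 i) //= rd_pair_cor ltr_pwDl // sumr_ge0 // => l _.
by rewrite -expr2 sqr_ge0.
Qed.

Lemma pair_cor_sign i j : (0 < pair (cor i) j) = (0 < pair (cor j) i).
Proof.
have := invform_pair i j; have := invform_pair j i; rewrite [invform j i]invformC.
have := invform_gt0 i; have := invform_gt0 j; nia.
Qed.

Lemma pair_cor_mul_le4 i j : pair (cor i) j * pair (cor j) i <= 4.
Proof.
set n := pair (cor i) j; set m := pair (cor j) i.
(* Cauchy-Schwarz in integral form: by [invform_pair] this sum of squares equals [(4 - n m)] times
   [invform j j]. *)
have : 0 <= \sum_l (n * pair (cor l) i - 2 * pair (cor l) j) ^+ 2.
  by apply: sumr_ge0 => l _; apply: sqr_ge0.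
have -> : \sum_l (n * pair (cor l) i - 2 * pair (cor l) j) ^+ 2 =
    n ^+ 2 * invform i i - 4 * n * invform i j + 4 * invform j j.
  rewrite /invform !mulr_sumr -sumrB -big_split; apply: eq_bigr => l _ /=; ring.
have := invform_pair i j; have := invform_pair j i; rewrite [invform j i]invformC -/n -/m.
have := invform_gt0 i; have := invform_gt0 j.
set A := invform i i; set C := invform j j; set E := invform i j => hC hA h1 h2 h3.
have h4 : (4 - n * m) * C = n ^+ 2 * A - 4 * n * E + 4 * C.
  have -> : n ^+ 2 * A = n * (n * A) by ring.
  have -> : (4 - n * m) * C = 4 * C - n * (m * C) by ring.
  by rewrite -h1 -h2; ring.
by move: h3; rewrite -h4 pmulr_lge0 //; lia.
Qed.

(** If the product is 4, then [s_i s_j] translates by [d] all roots with the same pairings as [i]. A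
    nonzero [d] contradicts finiteness, and [d = 0] makes the two roots proportional, against
    reducedness. *)
Lemma pair_cor_mul_le3 i j : j != i -> j != neg i ->
  pair (cor i) j * pair (cor j) i <= 3.
Proof.
move=> ji jni; have := pair_cor_mul_le4 i j; rewrite le_eqVlt => /orP [/eqP e4|]; last by lia.
set n := pair (cor i) j in e4 *; set m := pair (cor j) i in e4 *.
pose d := 2%:R *: rt i - m%:~R *: rt j.
case: (eqVneq d 0) => [d0|dn0].
  have e : rt i = (m%:~R / 2%:R) *: rt j.
    apply: (@scalerI _ _ (2%:R : rat)) => //.
    by rewrite scalerA mulrC divfK //; apply/subr0_eq.
  have [h|h] := rd_reduced e; move: e; rewrite h ?scale1r ?scaleN1r.
    by move=> /rd_rt_inj ij; rewrite ij eqxx in ji.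
  by rewrite -rt_neg => /rd_rt_inj ij; rewrite ij negK eqxx in jni.
case: (@no_arith_prog d (fun p => pair (cor i) p = 2 /\ pair (cor j) p = m) dn0 _ i).
  move=> p [hi hj]; exists (sact i (sact j p)).
    rewrite !pair_sact !rd_pair_cor hi hj -/n -/m; have e4C : m * n = 4 by rewrite mulrC.
    by rewrite e4C; split; lia.
  rewrite !rt_sact pair_sact hi hj -/n /d.
  have -> : 2 - m * n = -2 by lia.
  by apply/rowP => c; rewrite !mxE; ring.
by rewrite rd_pair_cor.
Qed.

Lemma pair_cor_ge2 i j : j != i -> j != neg i -> 2 <= pair (cor i) j ->
  pair (cor j) i = 1 /\ pair (cor i) j <= 3.
Proof.
move=> ji jni h; have := pair_cor_mul_le3 ji jni; have := pair_cor_sign i j.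
set m := pair (cor j) i; set n := pair (cor i) j in h *; case: (ltP 0 m); last lia.
nia.
Qed.

(** * Positive roots *)

Definition co j : 'I_N -> int :=
  sval (constructive_indefinite_description _ (rd_simp_span j)).

Lemma co_spec j : (forall i, ~~ simp i -> co j i = 0) /\
  rt j = \sum_i (co j i)%:~R *: rt i /\
  ((forall i, 0 <= co j i) \/ (forall i, co j i <= 0)).
Proof. by rewrite /co; case: constructive_indefinite_description. Qed.

Lemma simp_free_int (z : 'I_N -> int) : (forall i, ~~ simp i -> z i = 0) ->
  \sum_i (z i)%:~R *: rt i = 0 -> forall i, z i = 0.
Proof.
move=> z0 hz i; apply/eqP; rewrite -(intr_eq0 rat); apply/eqP.
by apply: (rd_simp_free (a := fun i => (z i)%:~R)) => // k /z0 ->.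
Qed.

Lemma lin_co i : lin (fun j => co j i).
Proof.
move=> z hz; pose y i := \sum_j z j * co j i.
apply: (@simp_free_int y) => [k hk|]; rewrite /y.
  by rewrite big1 // => j _; rewrite (co_spec j).1 // mulr0.
rewrite -[RHS]hz; under eq_bigr => k _ do rewrite rmorph_sum scaler_suml /=.
rewrite exchange_big; apply: eq_bigr => j _ /=.
rewrite (co_spec j).2.1 scaler_sumr; apply: eq_bigr => k _.
by rewrite rmorphM scalerA.
Qed.

Lemma lin_coE (f : 'I_N -> int) j : lin f -> f j = \sum_i co j i * f i.
Proof.
move=> /(_ (fun l => (l == j)%:Z - co j l)) hf; apply/esym/subr0_eq.
have : \sum_i (i == j)%:Z * f i - \sum_i co j i * f i = 0.
  rewrite -sumrB -[RHS]hf; first by apply: eq_bigr => i _; rewrite mulrBl.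
  under eq_bigr => i _ do rewrite rmorphB scalerBl /= -pmulrn scaler_nat.
  by rewrite sumrB sum_delta -(co_spec j).2.1 subrr.
under eq_bigr => i _ do rewrite -natz mulr_natl.
by rewrite sum_delta => e; rewrite -opprB e oppr0.
Qed.

(** The height of a root. It is linear and never zero on roots, so positivity becomes a question
    about the sign of an integer. *)
Definition ht j : int := \sum_i co j i.

Lemma lin_ht : lin (ht).
Proof.
move=> z hz; rewrite /ht; under eq_bigr => j _ do rewrite mulr_sumr.
by rewrite exchange_big big1 // => i _; apply: lin_co.
Qed.

Lemma ht_gt0 j : (0 < ht j) <-> (forall i, 0 <= co j i).
Proof.
have [_ [e s]] := co_spec j; split=> [h|h].
  case: s => // s; have : ht j <= 0 by apply: sumr_le0 => i _; apply: s.
  by rewrite leNgt h.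
rewrite lt0r; apply/andP; split; last by apply: sumr_ge0 => i _; apply: h.
apply/eqP => /eqP; rewrite psumr_eq0; last by move=> i _; apply: h.
move=> /allP h0; case/eqP: (rd_rt_neq0 j); rewrite e big1 // => i _.
by have /eqP -> := h0 i (mem_index_enum i); rewrite scale0r.
Qed.

Lemma posE j : pos j = (0 < ht j).
Proof.
rewrite /pos /posv; apply/(sameP (decPP _))/(iffP idP).
  move=> /ht_gt0 h; split; first by exists j.
  exists (fun i => absz (co j i)); split=> [i /(co_spec j).1 -> //|].
  rewrite {1}(co_spec j).2.1; apply: eq_bigr => i _.
  by rewrite pmulrn abszE ger0_norm.
case=> _ [z [z0 e]]; apply/ht_gt0 => i.
suff -> : co j i = (z i)%:Z by [].
apply/subr0_eq; move: i; apply: simp_free_int => [i hi|].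
  by rewrite z0 // (co_spec j).1.
under eq_bigr => i _ do rewrite rmorphB scalerBl /= -pmulrn.
by rewrite sumrB -e -(co_spec j).2.1 subrr.
Qed.

Lemma ht_neg j : ht (neg j) = - ht j.
Proof. exact: (lin_neg _ lin_ht). Qed.

Lemma ht_neq0 j : ht j != 0.
Proof.
have [_ [_ [s|s]]] := co_spec j; first by rewrite gt_eqF //; apply/ht_gt0.
rewrite -oppr_eq0 -ht_neg gt_eqF //; apply/ht_gt0 => i.
by rewrite (lin_neg _ (lin_co i)) oppr_ge0.
Qed.

Lemma pos_neg j : pos (neg j) = ~~ pos j.
Proof. by rewrite !posE ht_neg; move: (ht_neq0 j); lia. Qed.

Lemma PhiPE j : PhiP (rt j) = (pos j)%:Z.
Proof. by []. Qed.

Lemma PhiPN j : PhiP (- rt j) = (~~ pos j)%:Z.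
Proof. by rewrite -rt_neg PhiPE pos_neg. Qed.

Lemma co_simp_id i l : simp i -> co i l = (l == i)%:Z.
Proof.
move=> si; apply/subr0_eq; move: l; apply: simp_free_int => [l hl|].
  rewrite (co_spec i).1 //; case: eqP => // e; by rewrite e si in hl.
under eq_bigr => l _ do rewrite rmorphB scalerBl /= -[(_ == _)%:~R]pmulrn scaler_nat.
by rewrite sumrB sum_delta -(co_spec i).2.1 subrr.
Qed.

Lemma pos_simp i : simp i -> pos i.
Proof. by move=> si; rewrite posE; apply/ht_gt0 => l; rewrite co_simp_id. Qed.

(** Some coordinate of [j] away from [i] is positive, as otherwise [j] would be a multiple of [i].
    The reflection leaves it unchanged, and all coordinates of a root share one sign. *)
Lemma pos_sact_simp i j : simp i -> pos j -> j != i -> pos (sact i j).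
Proof.
move=> si pj ji; have := pj; rewrite posE => /ht_gt0 cj.
have [l li cl] : exists2 l, l != i & 0 < co j l.
  have [/existsP [l /andP [li cl]]|/existsPn h] :=
    boolP [exists l, (l != i) && (0 < co j l)]; first by exists l.
  have e : rt j = (co j i)%:~R *: rt i.
    rewrite {1}(co_spec j).2.1 (bigD1 i) //= big1 ?addr0 // => l li.
    have := h l; rewrite li /= -leNgt => h'.
    by (have -> : co j l = 0 by move: (cj l); lia); rewrite scale0r.
  case: (rd_reduced e) => c; last by have := cj i; rewrite -(ler_int rat) c.
  by move: e; rewrite c scale1r => /rd_rt_inj e; rewrite e eqxx in ji.
rewrite posE; have [_ [_ [s|/(_ l)]]] := co_spec (sact i j); first exact/ht_gt0.
by rewrite (lin_sact _ _ (lin_co l)) (co_simp_id l si) (negPf li) mulr0 subr0 leNgt cl.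
Qed.

Lemma pos_wact_simp w j : w \in W -> (forall i, simp i -> pos (wact w i)) ->
  pos j -> pos (wact w j).
Proof.
move=> wW h; rewrite !posE => hj; rewrite lt0r ht_neq0 /=.
rewrite -[ht _]/((ht \o wact w) j) (lin_coE j (lin_wact wW lin_ht)) /=.
apply: sumr_ge0 => i _; have [si|nsi] := boolP (simp i).
  apply: mulr_ge0; first by move/ht_gt0: hj.
  by have := h i si; rewrite posE => /ltW.
by rewrite (co_spec j).1 ?mul0r.
Qed.

(** * Length in the finite Weyl group *)

(** Counts the positive roots that stay positive, so that [npos 1 - npos u] is the number of
    inversions; [coxlenE] identifies the latter with the Coxeter length. *)
Definition npos u : int := \sum_(j | pos j) (pos (wact u j))%:Z.

Definition delta u j : int :=
  npos u - npos (u * srefl j)%g + two_rho j * (~~ pos (wact u j))%:Z.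

(** The positive roots that [s_j] keeps positive are permuted by it, so their contributions
    cancel. *)
Lemma sum_sact_anti j (F : 'I_N -> int) : (forall b, F (sact j b) = - F b) ->
  \sum_(b | pos b) F b = \sum_(b | pos b && ~~ pos (sact j b)) F b.
Proof.
move=> hF; rewrite (bigID (fun b => pos (sact j b))) /=.
rewrite [X in X + _](_ : _ = 0) ?add0r //.
set S := \sum_(_ | _) _; suff : S = - S by lia.
rewrite {1}/S (reindex_inj (can_inj (sactK j))) -sumrN.
by apply: eq_big => [b|b _]; [rewrite sactK andbC | rewrite hF].
Qed.

Lemma two_rhoE j : two_rho j = \sum_(b | pos b && ~~ pos (sact j b)) pair (cor j) b.
Proof. by apply: sum_sact_anti => b; rewrite pair_cor_sact. Qed.

Lemma pos_wact_neg w j : w \in W -> pos (wact w (neg j)) = ~~ pos (wact w j).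
Proof. by move=> wW; rewrite wact_neg // pos_neg. Qed.

Lemma mul_W u v : u \in W -> v \in W -> (u * v)%g \in W.
Proof. exact: groupM. Qed.

Lemma mul_srefl_W u j : u \in W -> (u * srefl j)%g \in W.
Proof. by move=> uW; rewrite groupM ?srefl_W. Qed.

(** As a sum over the positive roots made negative by [s_j], [delta] has only nonnegative terms, and
    the term of [j] itself is 1. *)
Lemma delta_ge1 u j : u \in W -> pos j -> 1 <= delta u j.
Proof.
move=> uW pj; pose c : int := (~~ pos (wact u j))%:Z.
pose F b : int := (pos (wact u b))%:Z - (pos (wact u (sact j b)))%:Z.
have -> : delta u j = \sum_(b | pos b && ~~ pos (sact j b)) (F b + pair (cor j) b * c).
  rewrite big_split /= -mulr_suml -two_rhoE -sum_sact_anti.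
    rewrite /delta /npos /F sumrB; congr (_ - _ + _).
    by apply: eq_bigr => b _; rewrite wactM wact_srefl.
  by move=> b; rewrite /F sactK opprB.
have jI : pos j && ~~ pos (sact j j) by rewrite sact_id pos_neg pj.
rewrite (bigD1 j) //= rd_pair_cor /F sact_id pos_wact_neg // /c.
rewrite -[1]addr0; apply: lerD; first by case: (pos (wact u j)).
apply: sumr_ge0 => b /andP [/andP [pb]]; rewrite -pos_neg => pb' _.
have lu := lin_wact uW lin_ht.
have h1 : ht (wact u (sact j b)) = ht (wact u b) - pair (cor j) b * ht (wact u j).
  exact: (lin_sact j b lu).
have n0 : 0 < pair (cor j) b.
  move: pb pb' pj; rewrite !posE ht_neg (lin_sact _ _ lin_ht).
  case: (ltP 0 (pair (cor j) b)) => // h; nia.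
rewrite !posE h1; set n := pair _ _ in n0 *; set x := ht (wact u b); set y := ht (wact u j).
have : (0 < y) -> 0 < n * y by move=> h; apply: mulr_gt0.
case: (ltP 0 y) => hy /=; first by move=> /(_ isT); set z := n * y; case: (ltP 0 x); lia.
by move=> _; lia.
Qed.

(** The length differences cancel, and exactly one of [u] and [u s_j] makes [j] negative. This turns
    the lower bound on [delta] into an upper one. *)
Lemma delta_sum u j : u \in W ->
  delta u j + delta (u * srefl j)%g j = two_rho j.
Proof.
move=> uW; rewrite /delta -mulgA srefl2 mulg1 wactM wact_srefl sact_id pos_wact_neg //.
by case: (pos _); rewrite /= ?mulr1 ?mulr0; ring.
Qed.

Lemma delta_le u j : u \in W -> pos j -> delta u j <= two_rho j - 1.
Proof.
move=> uW pj; have := delta_sum j uW.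
by have := delta_ge1 (mul_srefl_W j uW) pj; lia.
Qed.

Lemma two_rho_simp i : simp i -> two_rho i = 2.
Proof.
move=> si; rewrite two_rhoE (bigD1 i) /=; last by rewrite sact_id pos_neg pos_simp.
rewrite rd_pair_cor big1 ?addr0 // => b /andP [/andP [pb]] nb bi.
by rewrite pos_sact_simp in nb.
Qed.

Lemma delta_simp u i : u \in W -> simp i -> delta u i = 1.
Proof.
move=> uW si; have := delta_ge1 uW (pos_simp si); have := delta_le uW (pos_simp si).
by rewrite two_rho_simp //; lia.
Qed.

Lemma npos_simp u i : u \in W -> simp i ->
  npos (u * srefl i)%g = npos u - 1 + 2 * (~~ pos (wact u i))%:Z.
Proof. by move=> uW si; have := delta_simp uW si; rewrite /delta two_rho_simp //; lia. Qed.

(** Expanding [invform j j > 0] in simple roots yields a simple [i] with positive coefficient and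
    positive inner product with [j]; reflecting in it lowers the height. *)
Lemma simp_descent_ht j : pos j -> ~~ simp j ->
  exists2 i, simp i & pos (sact i j) && (ht (sact i j) < ht j).
Proof.
move=> pj nj; have := pj; rewrite posE => /ht_gt0 cj.
have : 0 < \sum_i co j i * invform j i by rewrite -(lin_coE j (lin_invform j)) invform_gt0.
have [/existsP [i hi] _|/existsPn h] := boolP [exists i, 0 < co j i * invform j i]; last first.
  by rewrite ltNge sumr_le0 // => i _; rewrite leNgt h.
have si : simp i.
  by apply: contraTT hi => nsi; rewrite (co_spec j).1 ?mul0r ?ltxx.
exists i => //; rewrite pos_sact_simp //=; last by apply: contraNneq nj => ->.
have p0 : 0 < pair (cor i) j.
  have := invform_pair i j; have := invform_gt0 i; have := cj i.
  move: hi; rewrite invformC; nia.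
have := pos_simp si; rewrite posE (lin_sact _ _ lin_ht); nia.
Qed.

Definition simp_word s w := all simp s /\ prodw s = w.

Lemma srefl_simp_word j : exists s, simp_word s (srefl j).
Proof.
have main n i : pos i -> ht i <= n%:Z -> exists s, simp_word s (srefl i).
  elim: n i => [|n IH] i pi; first by move: pi; rewrite posE; lia.
  have [si|nsi] := boolP (simp i).
    by move=> _; exists [:: i]; split; rewrite /= ?si // /prodw big_seq1 sreflE.
  have [k sk /andP [pk hk]] := simp_descent_ht pi nsi => hn.
  have [|s [hs es]] := IH _ pk; first by lia.
  exists (k :: rcons s k); split; first by rewrite /= all_rcons sk hs.
  rewrite prodw_cons prodw_rcons es -sreflE -wact_srefl srefl_wact ?srefl_W //.
  by rewrite mulgA srefl2 mul1g.
have [pj|nj] := boolP (pos j); first by apply: (main (absz (ht j))) => //; lia.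
rewrite -srefl_neg; apply: (main (absz (ht (neg j)))); last by lia.
by rewrite pos_neg.
Qed.

Lemma W_simp_word w : w \in W -> exists s, simp_word s w.
Proof.
elim/W_ind_srefl => [|i u _ [s [hs <-]]]; first by exists [::]; split; rewrite // /prodw big_nil.
have [t [ht et]] := srefl_simp_word i.
by exists (t ++ s); split; rewrite ?all_cat ?hs ?ht // prodw_cat et.
Qed.

(** The exchange condition: applying the letters from the right, the first one to make the image of
    [a] negative must have that image as its simple root, and it cancels against [srefl a]. *)
Lemma exchange s a : all simp s -> simp a -> ~~ pos (wact (prodw s) a) ->
  exists2 t, simp_word t (prodw s * srefl a)%g & (size t).+1 = size s.
Proof.
move=> hs sa; elim: s hs => [_|i s IH /= /andP [si hs]].
  by rewrite /prodw big_nil wact1 pos_simp.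
rewrite prodw_cons -sreflE wactM wact_srefl.
have [pb nb|nb _] := boolP (pos (wact (prodw s) a)); last first.
  have [t [ht et] <-] := IH hs nb; exists (i :: t) => //.
  by split; rewrite /= ?si ?ht // prodw_cons et mulgA (sreflE i).
exists s => //; split=> //.
have e : wact (prodw s) a = i by apply: contraNeq nb => ne; apply: pos_sact_simp.
by rewrite -e (srefl_wact _ (prodw_W s)) -mulgA srefl2 mulg1.
Qed.

(** The prefix before the last letter [a] of a word must make [a] negative, so [exchange] yields a
    word for the same element that is shorter by two. *)
Lemma pos_stable_id w : w \in W -> (forall j, pos j -> pos (wact w j)) -> w = 1%g.
Proof.
move=> /W_simp_word [s [hs <-]]; elim/ltn_ind: (size s) {-2}s (erefl (size s)) hs => n IH {}s en.
case/lastP: s en => [_ _ _|s a]; first by rewrite /prodw big_nil.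
rewrite size_rcons all_rcons => en /andP [sa hs] h.
have h' := h; have := h a (pos_simp sa).
rewrite prodw_rcons -sreflE wactM wact_srefl sact_id pos_wact_neg ?prodw_W // => na.
have [t [ht et] st] := exchange hs sa na.
rewrite -et; apply: (IH (size t)) => //; first by rewrite -en -st; lia.
by move=> j /h'; rewrite prodw_rcons -sreflE et.
Qed.

Lemma npos1 u : u \in W -> npos u <= npos 1%g /\ (npos u = npos 1%g -> u = 1%g).
Proof.
move=> uW; have le b : pos b -> (pos (wact u b))%:Z <= (pos (wact 1%g b))%:Z :> int.
  by rewrite wact1 => ->; case: (pos _).
split; first exact: ler_sum.
move=> e; apply: pos_stable_id => // j pj; apply/negPn/negP => nj.
have : npos u < npos 1%g; last by rewrite e ltxx.
rewrite /npos (bigD1 j) //= [ltRHS](bigD1 j) //= ltr_leD //.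
  by rewrite (negPf nj) wact1 pj.
by apply: ler_sum => b /andP [/le].
Qed.

Lemma npos_word n w : w \in W -> npos 1%g - npos w = n%:Z ->
  exists2 s, simp_word s w & size s = n.
Proof.
elim: n w => [|n IH] w wW e.
  have -> : w = 1%g by apply: (npos1 wW).2; move: e; lia.
  by exists [::] => //; split=> //; rewrite /prodw big_nil.
have [/existsP [i /andP [si ni]]|/existsPn h] := boolP [exists i, simp i && ~~ pos (wact w i)].
  have wsW := mul_srefl_W i wW.
  have [|s [hs es] <-] := IH _ wsW; first by rewrite npos_simp // ni; move: e; lia.
  exists (rcons s i); rewrite ?size_rcons //; split; first by rewrite all_rcons si.
  by rewrite prodw_rcons es -sreflE -mulgA srefl2 mulg1.
suff w1 : w = 1%g by move: e; rewrite w1 subrr.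
apply: pos_stable_id => // j; apply: pos_wact_simp => // i si.
by have := h i; rewrite si /= negbK.
Qed.

Lemma npos_le_size s : all simp s -> npos 1%g - npos (prodw s) <= (size s)%:Z.
Proof.
elim/last_ind: s => [|s i IH]; first by rewrite /prodw big_nil subrr.
rewrite all_rcons size_rcons prodw_rcons -sreflE => /andP [si /IH].
by rewrite npos_simp ?prodw_W //; case: (pos _) => /=; lia.
Qed.

Lemma coxlenE w : w \in W -> (coxlen w)%:Z = npos 1%g - npos w.
Proof.
move=> wW; have [n en] : exists n, npos 1%g - npos w = n%:Z.
  by exists (absz (npos 1%g - npos w)); have := (npos1 wW).1; lia.
have [s [hs es] ss] := npos_word wW en.
have lb t : all simp t -> prodw t = w -> (n <= size t)%N.
  by move=> /npos_le_size h e; move: h; rewrite e en; lia.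
rewrite /coxlen; case: (epsilon_spec (inhabits 0%N) (fun k : nat => (exists t, size t = k /\
   all simp t /\ prodw t = w) /\ forall t, all simp t -> prodw t = w -> (k <= size t)%N)).
  by exists n; split=> //; exists s.
set k := epsilon _ _ => -[t [ht [at_ et]]] hk; rewrite en; congr Posz.
by apply/eqP; rewrite eqn_leq -{1}ss hk // -ht lb.
Qed.

(** * The quantum Bruhat graph *)

(** Makes the root of an edge unique, so that the weight chosen in [qb_wt] is determined. *)
Lemma srefl_inj_pos i j : pos i -> pos j -> srefl i = srefl j -> i = j.
Proof.
move=> pi pj e; have : sact i j = neg j by rewrite -sact_id -!wact_srefl e.
move=> /(congr1 rt); rewrite rt_sact rt_neg; set c := pair _ _ => h.
have e2 : rt j = (c%:~R / 2%:R) *: rt i.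
  apply: (@scalerI _ _ (2%:R : rat)) => //; rewrite scalerA mulrC divfK //.
  apply/subr0_eq; rewrite scaler_nat mulr2n -[X in _ + X - _]opprK -h.
  by apply/rowP => k; rewrite !mxE; ring.
case: (rd_reduced e2) => hc; move: e2; rewrite hc ?scale1r ?scaleN1r.
  by move/rd_rt_inj.
by rewrite -rt_neg => /rd_rt_inj ej; move: pj; rewrite ej pos_neg pi.
Qed.

Lemma deltaE u j : u \in W ->
  delta u j = (coxlen (u * srefl j)%g)%:Z - (coxlen u)%:Z
              + two_rho j * (~~ pos (wact u j))%:Z.
Proof. by move=> uW; rewrite !coxlenE ?mul_srefl_W // /delta; lia. Qed.

(** Because [1 <= delta <= two_rho j - 1], either length condition determines the sign of
    [wact u j]: upward edges keep [j] positive and quantum edges make it negative. *)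
Lemma qb_alt u j : u \in W -> pos j ->
  (coxlen (u * srefl j)%g = (coxlen u).+1 -> delta u j = 1 /\ pos (wact u j)) /\
  ((coxlen (u * srefl j)%g)%:Z = (coxlen u)%:Z + 1 - two_rho j ->
     delta u j = 1 /\ ~~ pos (wact u j)).
Proof.
move=> uW pj; have h := deltaE j uW; have := delta_ge1 uW pj; have := delta_le uW pj.
by move: h; case: (pos _) => /=; rewrite ?mulr0 ?mulr1 => ->; split; lia.
Qed.

Lemma delta1_coxlen u j : u \in W -> delta u j = 1 ->
  if pos (wact u j) then coxlen (u * srefl j)%g = (coxlen u).+1
  else (coxlen (u * srefl j)%g)%:Z = (coxlen u)%:Z + 1 - two_rho j.
Proof.
by move=> uW; rewrite deltaE //; case: (pos _) => /=; rewrite ?mulr0 ?mulr1; lia.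
Qed.

Lemma qb_edgeP u u' : u \in W ->
  qb_edge u u' <-> exists j, [/\ pos j, u' = (u * srefl j)%g & delta u j = 1].
Proof.
move=> uW; split=> [[j [pj [-> h]]]|[j [pj -> dj]]].
  exists j; rewrite -sreflE in h *; split=> //.
  by case: h => h; [case: ((qb_alt uW pj).1 h) | case: ((qb_alt uW pj).2 h)].
exists j; rewrite -sreflE; do 2!split=> //.
by have := delta1_coxlen uW dj; case: (pos _); [left | right].
Qed.

Lemma qb_wtE u j : u \in W -> pos j -> delta u j = 1 ->
  qb_wt u (u * srefl j)%g = if pos (wact u j) then 0 else cor j.
Proof.
move=> uW pj dj; rewrite /qb_wt.
set Q := (Q in epsilon _ Q); have : Q (epsilon (inhabits 0) Q).
  apply: epsilon_spec; have := delta1_coxlen uW dj; case: (pos _) => h.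
    by exists 0, j; rewrite -sreflE; do 2!split=> //; left.
  by exists (cor j), j; rewrite -sreflE; do 2!split=> //; right.
set mu := epsilon _ _; case=> i [pi [/mulgI]]; rewrite -sreflE => e.
rewrite -(srefl_inj_pos pj pi e).
by case=> -[h ->]; [case: ((qb_alt uW pj).1 h) | case: ((qb_alt uW pj).2 h)] => _ => [->|/negPf ->].
Qed.

Lemma qb_path_cat u p u' q u'' :
  qb_path u p u' -> qb_path u' q u'' -> qb_path u (p ++ q) u''.
Proof.
elim: p u => [|v p IH] u /= => [->|[e h] h'] //.
by split=> //; apply: IH.
Qed.

(** Right multiplication by a simple reflection is always an edge, since [delta] is then 1. *)
Lemma qb_connected u u' : u \in W -> u' \in W -> exists p, qb_path u p u'.
Proof.
move=> uW u'W; have /W_simp_word [s [hs es]] : (u^-1 * u')%g \in W by rewrite groupM ?groupV.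
have -> : u' = (u * prodw s)%g by rewrite es mulKVg.
elim: s u uW hs {es u' u'W} => [|i s IH] u uW /=.
  by exists [::]; rewrite /prodw big_nil mulg1.
move=> /andP [si hs]; have [p hp] := IH _ (mul_srefl_W i uW) hs.
exists ((u * srefl i)%g :: p); split; last by rewrite prodw_cons -sreflE mulgA.
by apply/qb_edgeP => //; exists i; rewrite pos_simp // delta_simp.
Qed.

Lemma dQB_spec u u' : u \in W -> u' \in W ->
  (exists p, qb_path u p u' /\ size p = dQB u u') /\
  forall p, qb_path u p u' -> (dQB u u' <= size p)%N.
Proof.
move=> uW u'W; rewrite /dQB; set Q := (Q in epsilon _ Q).
suff : Q (epsilon (inhabits 0%N) Q) by [].
apply: epsilon_spec; rewrite /Q {Q}.
have [p hp] := qb_connected uW u'W.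
elim/ltn_ind: (size p) {-2}p (erefl (size p)) hp => n IH {}p en hp.
have [[q [hq sq]]|h] := excluded_middle_informative (exists q, qb_path u q u' /\ (size q < n)%N).
  exact: (IH (size q) sq q).
exists n; split; first by exists p.
by move=> q hq; rewrite leqNgt; apply/negP => sq; apply: h; exists q.
Qed.

Lemma wtQB_spec u u' : u \in W -> u' \in W ->
  exists p, [/\ qb_path u p u', size p = dQB u u' & wtQB u u' = pwt u p].
Proof.
move=> uW u'W; rewrite /wtQB; set Q := (Q in epsilon _ Q).
have [h1 h2] : Q (epsilon (inhabits [::]) Q).
  by apply: epsilon_spec; case: (dQB_spec uW u'W).
by exists (epsilon (inhabits [::]) Q); split.
Qed.

(** * Length positive elements *)

Implicit Types (x y z : Wt D).

Lemma ell_affE x b :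
  ell_aff x b = pair x.2 b + (pos b)%:Z - (pos (wact x.1 b))%:Z.
Proof. by []. Qed.

Lemma sum_pos_neg (F : 'I_N -> int) : \sum_j F j = \sum_(j | pos j) (F j + F (neg j)).
Proof.
rewrite (bigID (@pos D)) big_split /=; congr (_ + _).
rewrite (reindex_inj (can_inj negK)); apply: eq_bigl => j.
by rewrite pos_neg negbK.
Qed.

(** Over [b] and [-b] the intervals have signed lengths [ell_aff x b] and its negative. [nb_int]
    keeps the positive parts, which add up to the absolute value; [v] only reindexes the roots. *)
Lemma lenAE x v : x.1 \in W -> v \in W ->
  (lenA x)%:Z = \sum_(j | pos j) `|ell_aff x (wact v j)|.
Proof.
move=> xW vW; rewrite /lenA -natz raddf_sum (reindex_inj (@wact_inj v)) sum_pos_neg.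
apply: eq_bigr => j _; set b := wact v j.
rewrite wact_neg // -/b /= !natz /nb_int !PhiPN wact_neg // pair_neg !pos_neg ell_affE.
by case: (pos b); case: (pos _) => /=; lia.
Qed.

Definition Lsum x v : int := \sum_(j | pos j) ell_aff x (wact v j).

Lemma Lsum_le x v : x.1 \in W -> v \in W -> Lsum x v <= (lenA x)%:Z.
Proof. by move=> xW vW; rewrite (lenAE xW vW); apply: ler_sum => j _; apply: ler_norm. Qed.

Lemma LP_Lsum x v : x.1 \in W -> LP x v <-> v \in W /\ (lenA x)%:Z <= Lsum x v.
Proof.
move=> xW; split=> [[vW h]|[vW h]]; split=> //.
  by rewrite (lenAE xW vW) ler_sum // => j pj; rewrite ger0_norm // h.
move=> i pi; rewrite leNgt; apply/negP => hi; move: h; apply/negP; rewrite -ltNge.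
rewrite (lenAE xW vW) /Lsum (bigD1 i) //= [ltRHS](bigD1 i) //=.
rewrite ltr_leD ?ler_sum // => [|j _]; last exact: ler_norm.
by rewrite ltr0_norm //; lia.
Qed.

Definition rho2 mu : int := \sum_(i | pos i) pair mu i.

Lemma two_rho_rho2 j : two_rho j = rho2 (cor j).
Proof. by []. Qed.

Lemma rho2D mu nu : rho2 (mu + nu) = rho2 mu + rho2 nu.
Proof. by rewrite /rho2 -big_split; apply: eq_bigr => i _; apply: rd_pairD. Qed.

Lemma rho2N mu : rho2 (- mu) = - rho2 mu.
Proof. by rewrite /rho2 -sumrN; apply: eq_bigr => i _; apply: pairN. Qed.

Lemma rho2Mz mu (n : int) : rho2 (mu *~ n) = n * rho2 mu.
Proof. by rewrite /rho2 mulr_sumr; apply: eq_bigr => i _; apply: pairMz. Qed.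

Lemma LsumE x v : x.1 \in W -> v \in W ->
  Lsum x v = rho2 (wactX v^-1%g x.2) + npos v - npos (x.1 * v)%g.
Proof.
move=> xW vW; rewrite /Lsum /rho2 /npos -big_split -sumrB; apply: eq_bigr => j _ /=.
by rewrite ell_affE pair_wactXV // wactM.
Qed.

Lemma Lsum_srefl x v a : x.1 \in W -> v \in W ->
  Lsum x (v * srefl a)%g = Lsum x v + delta (x.1 * v)%g a - delta v a
    - two_rho a * ell_aff x (wact v a).
Proof.
move=> xW vW; rewrite !LsumE ?mul_srefl_W // invMg sreflV wactXM ?srefl_W ?groupV //.
rewrite wactX_srefl /reflX rho2D rho2N rho2Mz pair_wactXV // -two_rho_rho2.
rewrite /delta ell_affE wactM mulgA.
by case: (pos (wact v a)); case: (pos _) => /=; rewrite ?mulr0 ?mulr1; ring.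
Qed.

Lemma LP_exists x : x.1 \in W -> exists v, LP x v.
Proof.
move=> xW.
have main n v : v \in W -> (lenA x)%:Z - Lsum x v <= n%:Z -> exists u, LP x u.
  elim/ltn_ind: n v => n IH v vW hn.
  have [/existsP [b /andP [pb hb]]|/existsPn h] :=
    boolP [exists b, pos b && (ell_aff x (wact v b) < 0)]; last first.
    by exists v; split=> // i pi; have := h i; rewrite pi /= -leNgt.
  have := Lsum_srefl b xW vW; have := Lsum_le xW (mul_srefl_W b vW).
  have := delta_ge1 (mul_W xW vW) pb; have := delta_le vW pb.
  (* Passing from [v] to [v s_b] gains at least [two_rho b] here and loses only
     [delta v b <= two_rho b - 1], so the bounded quantity [Lsum] increases. *)
  have : two_rho b * ell_aff x (wact v b) <= - two_rho b.
    have := delta_ge1 vW pb; have := delta_le vW pb.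
    move: hb; set r := two_rho b; set l := ell_aff _ _; nia.
  move=> h1 h2 h3 h4 h5.
  by apply: (IH n.-1 _ (v * srefl b)%g); rewrite ?mul_srefl_W //; lia.
by apply: (main (absz ((lenA x)%:Z - Lsum x 1%g)) 1%g); rewrite ?group1 //; lia.
Qed.

(* [Lsum x (v * srefl a)] differs from [Lsum x v] by
   [delta (x.1 * v) a - 1 >= 0], but [Lsum x v] is already maximal. *)
Lemma LP_edge0 x v a : x.1 \in W -> LP x v -> pos a -> delta v a = 1 ->
  ell_aff x (wact v a) = 0 -> LP x (v * srefl a)%g.
Proof.
move=> xW /(LP_Lsum _ xW) [vW hL] pa da ea; apply/LP_Lsum => //.
split; first exact: mul_srefl_W.
rewrite (Lsum_srefl a xW vW) da ea mulr0 subr0.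
by have := delta_ge1 (mul_W xW vW) pa; lia.
Qed.

Lemma ell_aff_mul x y b : x.1 \in W -> y.1 \in W ->
  ell_aff (mulWt x y) b = ell_aff x (wact y.1 b) + ell_aff y b.
Proof.
move=> xW yW; rewrite !ell_affE /= rd_pairD pair_wactXV // wactM; lia.
Qed.

Lemma Lsum_mul x y v : x.1 \in W -> y.1 \in W ->
  Lsum (mulWt x y) v = Lsum x (y.1 * v)%g + Lsum y v.
Proof.
move=> xW yW; rewrite /Lsum -big_split; apply: eq_bigr => j _.
by rewrite ell_aff_mul // wactM.
Qed.

Lemma mulWt_W x y : x.1 \in W -> y.1 \in W -> (mulWt x y).1 \in W.
Proof. exact: groupM. Qed.

Lemma lenA_mul_le x y : x.1 \in W -> y.1 \in W -> (lenA (mulWt x y) <= lenA x + lenA y)%N.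
Proof.
move=> xW yW; have xyW := mulWt_W xW yW; have [v /(LP_Lsum _ xyW) [vW hv]] := LP_exists xyW.
have := Lsum_mul v xW yW; have := Lsum_le xW (mul_W yW vW); have := Lsum_le yW vW; lia.
Qed.

Lemma lenA_mul_eq x y : x.1 \in W -> y.1 \in W ->
  lenA (mulWt x y) = (lenA x + lenA y)%N -> exists2 v, LP y v & LP x (y.1 * v)%g.
Proof.
move=> xW yW e; have xyW := mulWt_W xW yW; have [v /(LP_Lsum _ xyW) [vW hv]] := LP_exists xyW.
have := Lsum_mul v xW yW; have := Lsum_le xW (mul_W yW vW); have := Lsum_le yW vW => h1 h2 h3.
have yvW := mul_W yW vW.
by exists v; apply/LP_Lsum => //; split=> //; lia.
Qed.

Lemma lenA_mul_LP x y v : x.1 \in W -> y.1 \in W -> LP y v -> LP x (y.1 * v)%g ->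
  lenA (mulWt x y) = (lenA x + lenA y)%N /\ LP (mulWt x y) v.
Proof.
move=> xW yW /(LP_Lsum _ yW) [vW hy] /(LP_Lsum _ xW) [yvW hx].
have xyW := mulWt_W xW yW.
have := Lsum_mul v xW yW; have := lenA_mul_le xW yW; have := Lsum_le xyW vW => h1 h2 h3.
split; first by lia.
by apply/LP_Lsum => //; split=> //; lia.
Qed.

(** * Affine reflections *)

Implicit Types (b c s : 'I_N * int).

Definition apos b : bool := (~~ pos b.1)%:Z <= b.2.
Definition aneg b : 'I_N * int := (neg b.1, - b.2).
Definition aact x b : 'I_N * int := (wact x.1 b.1, b.2 - pair x.2 b.1).
Definition arefl b : Wt D := (srefl b.1, cor b.1 *~ b.2).

Lemma raffE j (k : int) : raff j k = arefl (j, k).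
Proof. by rewrite /arefl /= sreflE. Qed.

Lemma arefl_W b : (arefl b).1 \in W.
Proof. exact: srefl_W. Qed.

Lemma apos_neg b : apos (aneg b) = ~~ apos b.
Proof. by rewrite /apos /aneg /= pos_neg; case: (pos _) => /=; lia. Qed.

Lemma aact_neg x b : x.1 \in W -> aact x (aneg b) = aneg (aact x b).
Proof. by move=> xW; rewrite /aact /aneg /= wact_neg // pair_neg; congr (_, _); lia. Qed.

Lemma aact_mul x y b : x.1 \in W -> y.1 \in W -> aact (mulWt x y) b = aact x (aact y b).
Proof.
by move=> xW yW; rewrite /aact /= wactM rd_pairD pair_wactXV //; congr (_, _); lia.
Qed.

Lemma arefl_neg b : arefl (aneg b) = arefl b.
Proof. by rewrite /arefl /aneg /= srefl_neg cor_neg mulNrz mulrNz opprK. Qed.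

Lemma aact_arefl b : aact (arefl b) b = aneg b.
Proof.
by rewrite /aact /aneg /= wact_srefl sact_id pairMz rd_pair_cor; congr (_, _); lia.
Qed.

Lemma mulWtA x y z : x.1 \in W -> y.1 \in W -> z.1 \in W ->
  mulWt x (mulWt y z) = mulWt (mulWt x y) z.
Proof.
move=> xW yW zW; rewrite /mulWt /= mulgA wactXD ?groupV // addrA.
by rewrite invMg wactXM ?groupV.
Qed.

Lemma mulWt_arefl x b : mulWt x (arefl b) = ((x.1 * srefl b.1)%g, reflX b.1 x.2 + cor b.1 *~ b.2).
Proof. by rewrite /mulWt /= sreflV wactX_srefl. Qed.

Lemma reflX_cor j : reflX j (cor j) = - cor j.
Proof. by rewrite /reflX rd_pair_cor -pmulrn mulr2n opprD addrA subrr add0r. Qed.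

Lemma reflXMz j mu (n : int) : reflX j (mu *~ n) = reflX j mu *~ n.
Proof. by rewrite -!wactX_srefl wactXMz ?srefl_W. Qed.

Lemma reflXK j : involutive (@reflX D j).
Proof. by move=> mu; rewrite -!wactX_srefl -wactXM ?srefl_W // srefl2 wactX1. Qed.

Lemma mulWt_areflK x b : mulWt (mulWt x (arefl b)) (arefl b) = x.
Proof.
rewrite !mulWt_arefl /= -mulgA srefl2 mulg1 reflXD reflXK reflXMz reflX_cor mulNrz.
by rewrite subrK; case: x.
Qed.

Lemma arefl_conj x b : x.1 \in W -> mulWt (arefl (aact x b)) x = mulWt x (arefl b).
Proof.
move=> xW; rewrite mulWt_arefl /mulWt /arefl /aact /=.
rewrite srefl_wact // cor_wact // wactXMz ?groupV // wactXK //; congr (_, _).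
by rewrite mulrzBr addrC addrA addrAC.
Qed.

Section Reflect.
Variables (x : Wt D) (v : {perm 'I_N}) (a : 'I_N) (k : int).
Hypotheses (xW : x.1 \in W) (vW : v \in W).
Let y := mulWt x (arefl (wact v a, k)).
Let nu := wactX v^-1%g x.2.

(** Seen in the frame of [v], the root [wact v a] becomes [a], so [LsumE] applies to [y] with
    explicit finite part and translation. *)
Lemma arefl_frame : (y.1 * v = x.1 * v * srefl a)%g /\
  wactX v^-1%g y.2 = reflX a nu + cor a *~ k.
Proof.
rewrite /y mulWt_arefl /= -!mulgA srefl_wact //; split=> //.
rewrite wactXD ?groupV // wactXMz ?groupV // cor_wact // wactXK //; congr (_ + _).
rewrite -!wactX_srefl -!wactXM ?groupV ?srefl_W //; congr wactX.
by apply: (mulgI v); apply: (mulIg v); rewrite mulKVg srefl_wact // -!mulgA mulVg mulg1.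
Qed.

Lemma Lsum_arefl : Lsum y v = Lsum x v + delta (x.1 * v)%g a
  + two_rho a * (k - pair x.2 (wact v a) - (~~ pos (wact x.1 (wact v a)))%:Z).
Proof.
have [e1 e2] := arefl_frame; have yW : y.1 \in W by rewrite mulWt_W ?arefl_W.
rewrite !LsumE // e1 e2 rho2D /reflX rho2D rho2N !rho2Mz -two_rho_rho2 -/nu.
by rewrite /delta wactM /nu pair_wactXV //; ring.
Qed.

Lemma Lsum_arefl_srefl : Lsum y (v * srefl a)%g = Lsum x v - delta v a
  + two_rho a * ((~~ pos (wact v a))%:Z - k).
Proof.
have [e1 e2] := arefl_frame; have yW : y.1 \in W by rewrite mulWt_W ?arefl_W.
rewrite !LsumE ?mul_srefl_W // invMg sreflV wactXM ?srefl_W ?groupV // e2 wactX_srefl.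
rewrite reflXD reflXK reflXMz reflX_cor mulNrz mulgA e1 -mulgA srefl2 mulg1 -/nu.
by rewrite rho2D rho2N rho2Mz -two_rho_rho2 /delta; ring.
Qed.
End Reflect.

(** Write [b] over [wact v a] with [a > 0]. If [b] and its image are positive, [Lsum] gains at least
    [delta (x.1 v) a] at [v]; if [b] is negative, it gains at least
    [two_rho a - delta v a = delta (v s_a) a] at [v s_a]. *)
Lemma Lsum_arefl_up x v b : x.1 \in W -> LP x v -> apos b = apos (aact x b) ->
  let y := mulWt x (arefl b) in
  (lenA x)%:Z + 1 <= Lsum y v \/
  exists2 a, pos a & (lenA x)%:Z + delta (v * srefl a)%g a <= Lsum y (v * srefl a)%g.
Proof.
move=> xW /(LP_Lsum _ xW) [vW hL] hb /=.
(* [b] and [aneg b] define the same reflection and satisfy the same hypothesis. *)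
wlog pa : b hb / pos (wact v^-1%g b.1).
  move=> H; have [|na] := boolP (pos (wact v^-1%g b.1)); first exact: H.
  rewrite -arefl_neg; apply: H; first by rewrite aact_neg // !apos_neg hb.
  by rewrite pos_wact_neg ?groupV.
case: b pa hb => g k /=; set a := wact v^-1%g g => pa.
have -> : g = wact v a by rewrite /a wactKV.
have r0 : 0 < two_rho a by have := delta_ge1 vW pa; have := delta_le vW pa; lia.
rewrite /apos /=; case: (lerP _ k) => hk /esym hx; [left | right; exists a => //].
  rewrite Lsum_arefl //; have := delta_ge1 (mul_W xW vW) pa.
  set t := k - _ - _; have t0 : 0 <= t by rewrite /t; lia.
  have := mulr_ge0 (ltW r0) t0; lia.
rewrite Lsum_arefl_srefl // -(delta_sum a vW).
set t := _ - k; have t0 : 0 <= t - 1 by rewrite /t; lia.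
have : 0 <= two_rho a * (t - 1) by rewrite mulr_ge0 // ltW.
by rewrite -(delta_sum a vW) mulrBr mulr1; lia.
Qed.

Lemma lenA_arefl_lt x b : x.1 \in W -> apos b = apos (aact x b) ->
  (lenA x < lenA (mulWt x (arefl b)))%N.
Proof.
move=> xW hb; have [v hv] := LP_exists xW; have [vW _] := hv.
have yW : (mulWt x (arefl b)).1 \in W by rewrite mulWt_W ?arefl_W.
have [h|[a pa h]] := Lsum_arefl_up xW hv hb.
  by have := Lsum_le yW vW; lia.
have vaW := mul_srefl_W a vW.
by have := Lsum_le yW vaW; have := delta_ge1 vaW pa; lia.
Qed.

(** The reflection sends [b] to its negative, so a sign change under [x] means no sign change under
    [x r_b], and [lenA_arefl_lt] applies in reverse. *)
Lemma lenA_areflE x b : x.1 \in W ->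
  (lenA x < lenA (mulWt x (arefl b)))%N = (apos b == apos (aact x b)).
Proof.
move=> xW; case: eqP => [|/eqP h]; first exact: lenA_arefl_lt.
set y := mulWt x _; have yW : y.1 \in W by rewrite mulWt_W ?arefl_W.
have := @lenA_arefl_lt y b yW; rewrite /y mulWt_areflK -/y => h'.
apply/negbTE; rewrite -leqNgt ltnW // h' // /y aact_mul ?arefl_W // aact_arefl aact_neg //.
by rewrite apos_neg; move: h; case: (apos b); case: apos.
Qed.

Lemma lenA_arefl_neq x b : x.1 \in W -> lenA (mulWt x (arefl b)) != lenA x.
Proof.
move=> xW; set y := mulWt x _; have yW : y.1 \in W by rewrite mulWt_W ?arefl_W.
case h : (apos b == apos (aact x b)); first by rewrite gtn_eqF // lenA_arefl_lt //; apply/eqP.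
rewrite ltn_eqF // -[X in (_ < lenA X)%N](mulWt_areflK x b) lenA_areflE //.
rewrite /y aact_mul ?arefl_W // aact_arefl aact_neg // apos_neg.
by move: h; case: (apos b); case: apos.
Qed.

(** * Simple affine roots *)

(** Simplicity is expressed through the effect of the reflection, which avoids singling out the
    highest root of each component. *)
Definition asimple b : Prop :=
  apos b /\ forall c, apos c -> c <> b -> apos (aact (arefl b) c).

(** Larger than every [|ht j|], so that the affine height [aht], which is linear, is positive
    exactly on positive affine roots. *)
Definition htbound : int := 1 + \sum_(j : 'I_N) `|ht j|.
Definition aht b : int := ht b.1 + b.2 * htbound.

Lemma htbound_gt j : `|ht j| < htbound.
Proof.
rewrite /htbound (bigD1 j) //= addrCA ltrDl ltr_pwDl //.
by apply: sumr_ge0 => i _; apply: normr_ge0.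
Qed.

Lemma aposE b : apos b = (0 < aht b).
Proof.
case: b => j k; rewrite /apos /aht /= posE; have := htbound_gt j; have := ht_neq0 j.
set h := ht j; set M := htbound => h0 hM.
case: (ltP 0 h) => hh /=.
  case: (leP 0 k) => hk; first by (have : 0 <= k * M by nia); lia.
  by (have : k * M <= - M by nia); lia.
case: (leP 1 k) => hk; first by (have : M <= k * M by nia); lia.
by (have : k * M <= 0 by nia); lia.
Qed.

Lemma aht_neg b : aht (aneg b) = - aht b.
Proof. by rewrite /aht /= ht_neg; ring. Qed.

Lemma aht_le0 b : ~~ apos b -> aht b < 0.
Proof. by rewrite -apos_neg aposE aht_neg oppr_gt0. Qed.

Section Descent.
Variable x : Wt D.
Hypothesis xW : x.1 \in W.
Let f j : int := ht (wact x.1 j) - pair x.2 j * htbound.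
Let hx b : int := f b.1 + b.2 * htbound.

Let hxE b : aht (aact x b) = hx b.
Proof. by rewrite /aht /hx /f /aact /=; ring. Qed.

Let lf : lin f.
Proof.
move=> u hu; rewrite /f; under eq_bigr => j _ do rewrite mulrBr mulrA.
by rewrite sumrB (lin_wact xW lin_ht hu) -mulr_suml (lin_pair _ hu) mul0r subr0.
Qed.

(** Induction on the affine height: a root that is not simple is replaced by a positive one of
    smaller height that [x] still makes negative, usually a summand in a decomposition of [b]. *)
Lemma asimple_descent_le (n : nat) b : apos b -> ~~ apos (aact x b) -> aht b <= n%:Z ->
  exists2 c, asimple c & ~~ apos (aact x c).
Proof.
elim: n b => [|n IH] b; first by rewrite aposE; lia.
move=> pb nb hn; have nb' := aht_le0 nb; rewrite hxE in nb'.
have [sb|] := excluded_middle_informative (asimple b); first by exists b.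
have smaller c : apos c -> hx c < 0 -> aht c < aht b -> exists2 c, asimple c & ~~ apos (aact x c).
  by move=> pc hc lc; apply: (IH c) => //; rewrite ?aposE ?hxE -?leNgt; lia.
have split c d : apos c -> apos d -> aht c + aht d = aht b -> hx c + hx d = hx b ->
    exists2 c, asimple c & ~~ apos (aact x c).
  move=> pc pd e1 e2; have := pc; have := pd; rewrite !aposE => h1 h2.
  case: (ltP (hx c) 0) => hc; first by apply: (smaller c) => //; lia.
  by apply: (smaller d) => //; lia.
move=> nsb; have [c [pc cb nr]] : exists c, [/\ apos c, c <> b & ~~ apos (aact (arefl b) c)].
  have [//|h] := excluded_middle_informative
    (exists c, [/\ apos c, c <> b & ~~ apos (aact (arefl b) c)]).
  case: nsb; split=> // c pc cb; apply/negPn/negP => nr; apply: h; by exists c.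
case: b c => i k [j l] in pb nb hn nb' smaller split nsb pc cb nr *.
pose m := pair (cor i) j.
(* [c'] is the negative of the reflection of [c] in [b], hence positive, and [c + c' = m b]. *)
pose c' : 'I_N * int := (neg (sact i j), k * m - l).
have pc' : apos c'.
  move: nr; rewrite -apos_neg /aneg /aact /arefl /= wact_srefl pairMz -/m.
  by rewrite opprB.
have sumg (g : 'I_N -> int) : lin g -> g (neg (sact i j)) = m * g i - g j.
  by move=> lg; rewrite (lin_neg _ lg) (lin_sact _ _ lg) -/m; ring.
have e1 : aht c' = m * aht (i, k) - aht (j, l).
  by rewrite /aht /= (sumg _ lin_ht); ring.
have e2 : hx c' = m * hx (i, k) - hx (j, l).
  by rewrite /hx /= (sumg _ lf); ring.
have m0 : 0 < m by move: pb pc pc'; rewrite !aposE e1; case: (ltP 0 m) => // hm; nia.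
(* Over the same finite root, [c] and [c'] lie symmetrically around [b]; the lower of the two
   serves. *)
have [ji|ji] := eqVneq j i.
  have m2 : m = 2 by rewrite /m ji rd_pair_cor.
  have lk : l != k by apply/eqP => lk; case: cb; rewrite ji lk.
  have hM : 0 < htbound by have := htbound_gt i; lia.
  rewrite m2 in e1 e2; have d1 : aht (j, l) = aht (i, k) + (l - k) * htbound.
    by rewrite /aht ji /=; ring.
  have d2 : hx (j, l) = hx (i, k) + (l - k) * htbound by rewrite /hx ji /=; ring.
  case: (ltgtP l k) lk => // hlk _.
    have h : (l - k) * htbound < 0 by rewrite pmulr_llt0 //; lia.
    by apply: (smaller (j, l)) => //; lia.
  have h : 0 < (l - k) * htbound by rewrite pmulr_lgt0 //; lia.
  by apply: (smaller c') => //; lia.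
have jn : j != neg i.
  by apply/eqP => e; move: m0; rewrite /m e pair_neg rd_pair_cor.
have [m1|m2] : m = 1 \/ 2 <= m by lia.
  by apply: (split (j, l) c') => //; rewrite ?e1 ?e2 m1; ring.
have [n1 m3] := pair_cor_ge2 ji jn m2.
pose j' := neg (sact i j); pose l' := k * m - l.
have j'i : j' != i.
  apply: contra_neq ji => e; apply: (can_inj (sactK i)).
  by rewrite sact_id; apply: (can_inj negK); rewrite negK.
have j'n : j' != neg i.
  apply: contra_neq jn => e; apply: (can_inj (sactK i)).
  rewrite -[neg i]sact_id sactK; apply: (can_inj negK); exact: e.
have m' : pair (cor i) j' = m by rewrite /j' pair_neg pair_cor_sact opprK.
have n1' : pair (cor j') i = 1 by case: (pair_cor_ge2 j'i j'n); rewrite ?m'.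
(* [d = b - c] and [e = b - c'], with [d + e = (2 - m) b]. If neither is positive, [m = 2] is
   impossible and [m = 3] gives the decomposition of [b] into [-d] and [-e]. *)
pose d : 'I_N * int := (sact j i, k - l); pose e : 'I_N * int := (sact j' i, k - l').
have d1 : aht d = aht (i, k) - aht (j, l).
  by rewrite /aht /= (lin_sact _ _ lin_ht) n1; ring.
have d2 : hx d = hx (i, k) - hx (j, l).
  by rewrite /hx /= (lin_sact _ _ lf) n1; ring.
have f1 : aht e = aht (i, k) - aht c'.
  by rewrite /aht /= (lin_sact _ _ lin_ht) n1' /j' /l'; ring.
have f2 : hx e = hx (i, k) - hx c'.
  by rewrite /hx /= (lin_sact _ _ lf) n1' /j' /l'; ring.
have [pd|nd] := boolP (apos d).
  by apply: (split (j, l) d) => //; rewrite ?d1 ?d2; ring.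
have [pe|ne] := boolP (apos e).
  by apply: (split c' e) => //; rewrite ?f1 ?f2; ring.
have [q2|q3] : m = 2 \/ m = 3 by move: m2 m3; rewrite -/m; clear; lia.
  by have := aht_le0 nd; have := aht_le0 ne; rewrite d1 f1 e1 q2; clear; lia.
apply: (split (aneg d) (aneg e)); rewrite ?apos_neg //.
  by rewrite !aht_neg d1 f1 e1 q3; ring.
have hxN (c : 'I_N * int) : hx (aneg c) = - hx c.
  by rewrite /hx /= (lin_neg _ lf); ring.
by rewrite !hxN d2 f2 e2 q3; ring.
Qed.

Lemma asimple_descent : (0 < lenA x)%N -> exists2 b, asimple b & ~~ apos (aact x b).
Proof.
rewrite /lenA lt0n sum_nat_eq0 => /forallPn [j]; rewrite negb_imply /= => hj.
(* The lowest positive level over [j]; a nonzero count over [j] includes it. *)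
pose b : 'I_N * int := (j, (~~ pos j)%:Z).
have pb : apos b by rewrite /apos.
apply: (@asimple_descent_le (absz (aht b)) b) => //; last by lia.
by move: hj; rewrite /apos /nb_int !PhiPN /aact /=; lia.
Qed.
End Descent.

(** Only roots over [b.1] can be counted. Of the two lowest levels there at most one is [b], so a
    count of two would expose another positive root made negative. *)
Lemma lenA_asimple b : asimple b -> (lenA (arefl b) <= 1)%N.
Proof.
case=> pb hb.
have key j : (nb_int (PhiP (- rt j)) (pair (arefl b).2 j + PhiP (- rt (wact (arefl b).1 j)))
             <= (j == b.1))%N.
  set hi := pair _ j + _; rewrite leqNgt; apply/negP => h.
  have bad (l : int) : (j, l) <> b -> (~~ pos j)%:Z <= l ->
      ~~ (l < hi).
    move=> jl /(hb (j, l)) /(_ jl); rewrite /hi /apos /aact PhiPN /=; lia.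
  move: h; rewrite /nb_int PhiPN; case: eqP => jb /= h.
    have := bad (~~ pos j)%:Z; have := bad ((~~ pos j)%:Z + 1).
    have : ((j, (~~ pos j)%:Z) : 'I_N * int) <> b \/ ((j, (~~ pos j)%:Z + 1) : 'I_N * int) <> b.
      case: (eqVneq b.2 (~~ pos j)%:Z) => hb2; [right | left] => e; move: hb2; rewrite -e /=.
        by lia.
      by rewrite eqxx.
    have lo1 : (~~ pos j)%:Z <= (~~ pos j)%:Z + 1 :> int by lia.
    by case=> ne h1 h2; [move: (h2 ne (lexx _)) | move: (h1 ne lo1)]; lia.
  have := bad (~~ pos j)%:Z; have ne : ((j, (~~ pos j)%:Z) : 'I_N * int) <> b.
    by move=> e; apply: jb; rewrite -e.
  by move=> /(_ ne (lexx _)); lia.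
apply: (@leq_trans (\sum_(j : 'I_N) (j == b.1))%N); first by apply: leq_sum => j _; apply: key.
by rewrite (bigD1 b.1) //= eqxx big1 // => j /negPf ->.
Qed.

(** * Bruhat order *)

(** Steps of length one, whose closure [bruC] consists of saturated chains. Membership in [W] is
    recorded because a [Wt] may carry any permutation. *)
Definition cov x y : Prop :=
  x.1 \in W /\ exists2 b, y = mulWt x (arefl b) & lenA y = (lenA x).+1.
Definition bruC : Wt D -> Wt D -> Prop := clos_refl_trans (Wt D) cov.

Lemma bru_stepP x y : bru_step x y <->
  exists2 b, y = mulWt x (arefl b) & (lenA x < lenA y)%N.
Proof.
split=> [[j [k [e h]]]|[[j k] e h]]; first by exists (j, k); rewrite -?raffE.
by exists j, k; rewrite raffE.
Qed.

Lemma mulWt_arefl_W x b : ((mulWt x (arefl b)).1 \in W) = (x.1 \in W).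
Proof. by rewrite mulWt_arefl /= groupMr ?srefl_W. Qed.

Lemma bru_W x y : bru x y -> (x.1 \in W) = (y.1 \in W).
Proof.
elim=> [{}x {}y /bru_stepP [b -> _]| |? ? ? _ -> _ ->] //.
by rewrite mulWt_arefl_W.
Qed.

Lemma bruC_bru x y : bruC x y -> bru x y.
Proof.
elim=> [{}x {}y [_ [b e h]]|?|? z ? _ h1 _ h2].
- by apply: rt_step; apply/bru_stepP; exists b => //; rewrite h.
- exact: rt_refl.
- exact: rt_trans h1 h2.
Qed.

Lemma bru_len x y : bru x y -> x = y \/ (lenA x < lenA y)%N.
Proof.
elim=> [{}x {}y /bru_stepP [b _ h]|?|? ? ? _ h1 _ h2]; [by right | by left |].
case: h1 => [->|h1] //; case: h2 => [<-|h2]; right=> //; exact: ltn_trans h1 h2.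
Qed.

Section SimpleReflection.
Variable s : 'I_N * int.
Hypothesis ss : asimple s.
Let r x := mulWt x (arefl s).

(** The monotonicity of [bup] and [bdown] is the form taken here by the lifting property of the
    Bruhat order. *)
Definition bup x := if (lenA x < lenA (r x))%N then r x else x.
Definition bdown x := if (lenA x < lenA (r x))%N then x else r x.

Lemma lenA_mul_asimple x : x.1 \in W ->
  lenA (r x) = (lenA x).+1 \/ lenA x = (lenA (r x)).+1.
Proof.
move=> xW; have rW : (r x).1 \in W by rewrite mulWt_arefl_W.
have h1 := lenA_asimple ss; have := lenA_mul_le xW (arefl_W s).
have := lenA_mul_le rW (arefl_W s); rewrite mulWt_areflK.
by have := lenA_arefl_neq s xW; rewrite -/(r x); lia.
Qed.

Let rK x : r (r x) = x.
Proof. exact: mulWt_areflK. Qed.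

Lemma bup_r x : x.1 \in W -> bup (r x) = bup x.
Proof.
move=> xW; have h := lenA_mul_asimple xW; rewrite /bup rK.
by case: (ltnP (lenA x) _) => h1; case: (ltnP _ (lenA x)) => h2 //; exfalso; lia.
Qed.

(** The simple reflection permutes the positive affine roots other than [s]. So for [b] different
    from [s] the reflected root [c] is positive with the same image, and the step persists after
    multiplying by [s]. *)
Lemma step_mul_asimple x y b : x.1 \in W -> y = mulWt x (arefl b) -> (lenA x < lenA y)%N ->
  y = r x \/ exists2 c, r y = mulWt (r x) (arefl c) & (lenA (r x) < lenA (r y))%N.
Proof.
move=> xW ey h.
wlog pb : b ey / apos b.
  move=> H; have [|nb] := boolP (apos b); first exact: H.
  by apply: (H (aneg b)); rewrite ?arefl_neg ?apos_neg.
have [bs|/eqP bs] := eqVneq b s; first by left; rewrite ey bs.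
right; pose c := aact (arefl s) b.
have ec : aact (arefl s) c = b.
  have e : mulWt (arefl s) (arefl s) = (1%g, 0).
    by rewrite mulWt_arefl /= srefl2 reflXMz reflX_cor mulNrz addNr.
  by rewrite /c -aact_mul ?arefl_W // e /aact /= wact1 pair0 subr0; case: (b).
have rW : (r x).1 \in W by rewrite mulWt_arefl_W.
have e : r y = mulWt (r x) (arefl c).
  rewrite /r ey -!mulWtA ?arefl_W //; congr mulWt.
  by rewrite -(arefl_conj c (arefl_W s)) ec.
exists c => //; rewrite e lenA_areflE // /r aact_mul ?arefl_W // ec.
by move: h; rewrite ey lenA_areflE // pb => /eqP <-; rewrite /c ss.2.
Qed.

Lemma bruC_bup_self x : x.1 \in W -> bruC x (bup x).
Proof.
move=> xW; rewrite /bup; case: ltnP => h; last exact: rt_refl.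
by apply: rt_step; split=> //; exists s => //; have := lenA_mul_asimple xW; lia.
Qed.

Lemma bruC_bup x y : bruC x y -> bruC (bup x) (bup y).
Proof.
elim=> [{}x {}y [xW [b ey ly]]|?|? ? ? _ h1 _ h2]; last 2 first.
- exact: rt_refl.
- exact: rt_trans h1 h2.
have hlt : (lenA x < lenA y)%N by rewrite ly.
have yW : y.1 \in W by rewrite ey mulWt_arefl_W.
have [ey2|[c ec hc]] := step_mul_asimple xW ey hlt.
  by rewrite ey2 bup_r //; apply: rt_refl.
have rW : (r x).1 \in W by rewrite mulWt_arefl_W.
have lx := lenA_mul_asimple xW; have ly' := lenA_mul_asimple yW.
rewrite {1}/bup; case: ltnP => hx.
  (* If [y s] were shorter than [y], its length would be that of [x], yet [x s] is longer than [x]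
     and shorter than [y s]. *)
  rewrite /bup; case: ltnP => hy; last by lia.
  by apply: rt_step; split=> //; exists c => //; lia.
apply: rt_trans (bruC_bup_self yW).
by apply: rt_step; split=> //; exists b.
Qed.

Lemma bruC_bdown x y : bruC x y -> bruC (bdown x) (bdown y).
Proof.
elim=> [{}x {}y [xW [b ey ly]]|?|? ? ? _ h1 _ h2]; last 2 first.
- exact: rt_refl.
- exact: rt_trans h1 h2.
have hlt : (lenA x < lenA y)%N by rewrite ly.
have yW : y.1 \in W by rewrite ey mulWt_arefl_W.
have lx := lenA_mul_asimple xW; have ly' := lenA_mul_asimple yW.
have rW : (r x).1 \in W by rewrite mulWt_arefl_W.
have [ey2|[c ec hc]] := step_mul_asimple xW ey hlt.
  rewrite /bdown ey2 rK -ey2 hlt ltnNge (ltnW hlt) /=.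
  exact: rt_refl.
rewrite /bdown; case: ltnP => hx; case: ltnP => hy.
- by apply: rt_step; split=> //; exists b.
- by lia.
- apply: (@rt_trans _ _ _ x); apply: rt_step; split=> //.
    by exists s; [rewrite -[LHS]rK | lia].
  by exists b.
- by apply: rt_step; split=> //; exists c => //; lia.
Qed.
End SimpleReflection.

(** Choose a simple descent [s] of [y]. The step from [x s] to [y s] has a saturated chain by
    induction, and [bup s] lifts it to a chain ending at [y]. *)
Lemma bru_step_bruC x y b : x.1 \in W -> y = mulWt x (arefl b) -> (lenA x < lenA y)%N ->
  bruC x y.
Proof.
have [n] := ubnP (lenA y); elim: n x y b => // n IH x y b hn xW ey hlt.
have yW : y.1 \in W by rewrite ey mulWt_arefl_W.
have [|s ss ns] := asimple_descent yW; first by lia.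
have ly : ~~ (lenA y < lenA (mulWt y (arefl s)))%N.
  by rewrite lenA_areflE // (negPf ns) ss.1.
have := lenA_mul_asimple ss yW => ly'.
have [ey2|[c ec hc]] := step_mul_asimple ss xW ey hlt.
  apply: rt_step; split=> //; exists s => //.
  by have := lenA_mul_asimple ss xW; rewrite -ey2; lia.
have xsW : (mulWt x (arefl s)).1 \in W by rewrite mulWt_arefl_W.
have h : bruC (mulWt x (arefl s)) (mulWt y (arefl s)) by apply: IH ec hc => //; lia.
apply: rt_trans (bruC_bup_self ss xW) _.
have := bruC_bup ss h; rewrite !(bup_r ss) // [bup s y]/bup (negPf ly); exact.
Qed.

Lemma bru_bruC x y : x.1 \in W -> bru x y -> bruC x y.
Proof.
move=> xW h; elim: h xW => [{}x {}y /bru_stepP [b ey h] xW|? _|? z ? h1 H1 _ H2 xW].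
- exact: bru_step_bruC ey h.
- exact: rt_refl.
- by apply: rt_trans (H1 xW) (H2 _); rewrite -(bru_W h1).
Qed.

Lemma bruC_LP y x v' : bruC y x -> LP y v' ->
  exists v p, [/\ LP x v, qb_path v p v' & (size p + lenA y <= lenA x)%N].
Proof.
move=> h; elim: h v' => [{}y {}x [yW [b ex lx]]|{}x|{}y z {}x _ H1 _ H2] v' hv.
- have xW : x.1 \in W by rewrite ex mulWt_arefl_W.
  have hb : apos b = apos (aact y b) by apply/eqP; rewrite -lenA_areflE // -ex lx.
  have [vW _] := hv; have := Lsum_arefl_up yW hv hb; rewrite -ex /= => -[h|[a pa h]].
    by exists v', [::]; split=> //=; [apply/LP_Lsum => //; split=> //; lia | lia].
  (* For a cover, [lenA y + delta <= Lsum x (v' s_a) <= lenA y + 1] forces [delta = 1], hence an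
     edge into [v']. *)
  have vaW := mul_srefl_W a vW; have := delta_ge1 vaW pa; have := Lsum_le xW vaW => h1 h2.
  exists (v' * srefl a)%g, [:: v']; split=> //=; last by lia.
    by apply/LP_Lsum => //; split=> //; lia.
  split=> //; apply/qb_edgeP => //; exists a; split=> //; last by lia.
  by rewrite -mulgA srefl2 mulg1.
- by exists v', [::]; split.
- have [v1 [p1 [h1 q1 l1]]] := H1 _ hv; have [v [p [h2 q2 l2]]] := H2 _ h1.
  by exists v, (p ++ p1); split=> //; [apply: qb_path_cat q1 | rewrite size_cat; lia].
Qed.

(** * Demazure products *)

Lemma lenA0_ell x v j : x.1 \in W -> v \in W -> lenA x = 0%N -> pos j ->
  ell_aff x (wact v j) = 0.
Proof.
move=> xW vW x0 pj; have := lenAE xW vW; rewrite x0 => /esym/eqP.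
rewrite psumr_eq0; last by move=> i _; apply: normr_ge0.
by move=> /allP /(_ j (mem_index_enum j)); rewrite pj normr_eq0 => /eqP.
Qed.

Lemma lenA0_LP x v : x.1 \in W -> lenA x = 0%N -> v \in W -> LP x v.
Proof. by move=> xW x0 vW; split=> // i pi; rewrite lenA0_ell. Qed.

Lemma lenA_mul0 x y : x.1 \in W -> y.1 \in W -> lenA y = 0%N -> lenA (mulWt x y) = lenA x.
Proof.
move=> xW yW y0; have [v hv] := LP_exists xW; have [vW _] := hv.
have uW : (y.1^-1 * v)%g \in W by rewrite mul_W ?groupV.
have := @lenA_mul_LP x y (y.1^-1 * v)%g xW yW (lenA0_LP yW y0 uW).
by rewrite mulKVg => /(_ hv) [-> _]; rewrite y0 addn0.
Qed.

Lemma bru_mul0 x x' y : x.1 \in W -> y.1 \in W -> lenA y = 0%N -> bru x x' ->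
  bru (mulWt x y) (mulWt x' y).
Proof.
move=> xW yW y0 h; elim: h xW => [{}x {}x' /bru_stepP [b ex h] xW|? _|? z ? h1 H1 _ H2 xW].
- have x'W : x'.1 \in W by rewrite ex mulWt_arefl_W.
  apply: rt_step; apply/bru_stepP.
  (* [c] is the preimage of [b] under [y], so that [r_b y = y r_c]. *)
  pose c : 'I_N * int := (wact y.1^-1%g b.1, b.2 + pair y.2 (wact y.1^-1%g b.1)).
  exists c; last by rewrite !lenA_mul0.
  rewrite ex -!mulWtA ?arefl_W //; congr mulWt; rewrite -(arefl_conj c yW).
  by rewrite /aact /c /= wactKV addrK; case: (b).
- exact: rt_refl.
- by apply: rt_trans (H1 xW) (H2 _); rewrite -(bru_W h1).
Qed.

Lemma bru_bup s x y : asimple s -> x.1 \in W -> bru x y -> bru (bup s x) (bup s y).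
Proof. by move=> ss xW h; apply/bruC_bru/bruC_bup/bru_bruC. Qed.

Lemma bru_bdown s x y : asimple s -> x.1 \in W -> bru x y -> bru (bdown s x) (bdown s y).
Proof. by move=> ss xW h; apply/bruC_bru/bruC_bdown/bru_bruC. Qed.

Lemma bru_bup_self s x : asimple s -> x.1 \in W ->
  bru x (bup s x) /\ bru (mulWt x (arefl s)) (bup s x).
Proof.
move=> ss xW; split; first exact/bruC_bru/bruC_bup_self.
rewrite -bup_r //; apply/bruC_bru/bruC_bup_self => //.
by rewrite mulWt_arefl_W.
Qed.

(** Induction on the length of [x2], peeling off a simple reflection on the right. The factorisation
    with additive lengths is what allows [lenA_mul_eq] and [bruC_LP] to be applied to the
    maximum. *)
Lemma demazure_exists x1 x2 : x1.1 \in W -> x2.1 \in W ->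
  exists x', [/\ bru x' x1, lenA (mulWt x' x2) = (lenA x' + lenA x2)%N &
    forall x1' x2', bru x1' x1 -> bru x2' x2 -> bru (mulWt x1' x2') (mulWt x' x2)].
Proof.
move=> x1W; have [n] := ubnP (lenA x2); elim: n x2 => // n IH x2 hn x2W.
have [x20|x20] := posnP (lenA x2).
  exists x1; split; [exact: rt_refl | by rewrite lenA_mul0 // x20 addn0|].
  move=> x1' x2' h1 h2; case: (bru_len h2) => [->|]; last by rewrite x20.
  by apply: bru_mul0 => //; rewrite (bru_W h1).
have [s ss ns] := asimple_descent x2W x20.
pose z := mulWt x2 (arefl s).
have zW : z.1 \in W by rewrite mulWt_arefl_W.
have sW := arefl_W s.
have ez : mulWt z (arefl s) = x2 by rewrite mulWt_areflK.
have lz : lenA x2 = (lenA z).+1.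
  have := lenA_mul_asimple ss x2W; have := lenA_areflE s x2W.
  by rewrite ss.1 (negPf ns) /= -/z; lia.
have [|x' [hx' lx' max]] := IH z _ zW; first by lia.
have x'W : x'.1 \in W by rewrite (bru_W hx').
pose m := mulWt x' z.
have mW : m.1 \in W by rewrite mulWt_W.
rewrite -/m in lx' max.
have ms : mulWt m (arefl s) = mulWt x' x2 by rewrite /m -mulWtA // ez.
(* [x2'] is [bdown s x2'] or its product with [s], and [bdown s x2'] lies below [z]; monotonicity of
   [bup s] concludes. *)
have ubound x1' x2' : bru x1' x1 -> bru x2' x2 -> bru (mulWt x1' x2') (bup s m).
  move=> h1 h2; have x1'W : x1'.1 \in W by rewrite (bru_W h1).
  have x2'W : x2'.1 \in W by rewrite (bru_W h2).
  have dz : bdown s x2 = z by rewrite /bdown lenA_areflE // ss.1 (negPf ns).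
  have := bru_bdown ss x2'W h2; rewrite dz => hd.
  have dW : (bdown s x2').1 \in W by rewrite (bru_W hd).
  have pW := mulWt_W x1'W dW.
  have [u1 u2] := bru_bup_self ss pW.
  have h := bru_bup ss pW (max _ _ h1 hd); apply: rt_trans h.
  move: u1 u2; rewrite -mulWtA // [in X in _ -> X -> _]/bdown /bdown.
  by case: ifP => // _ _; rewrite mulWt_areflK.
have [up|down] := ltnP (lenA m) (lenA (mulWt m (arefl s))).
  exists x'; rewrite -ms; split=> //.
    by have := lenA_mul_asimple ss mW; lia.
  by move=> x1' x2' h1 h2; have := ubound _ _ h1 h2; rewrite /bup up.
(* Here [m s < m], and [m = x'' * x2] with [x''] the reflection of [x'] in [z s]. *)
pose x'' := mulWt x' (arefl (aact z s)).
have e : mulWt x'' x2 = m.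
  rewrite -ez /x'' /m -mulWtA ?arefl_W ?mulWt_W //; congr mulWt.
  by rewrite mulWtA ?arefl_W // arefl_conj // -/z mulWt_areflK.
have x''W : x''.1 \in W by rewrite mulWt_arefl_W.
have lt : (lenA x'' < lenA x')%N.
  have pz : apos (aact z s).
    by rewrite /z aact_mul // aact_arefl aact_neg // apos_neg.
  have nz : ~~ apos (aact x' (aact z s)).
    rewrite -aact_mul // -/m; move: down; rewrite leqNgt lenA_areflE // ss.1.
    by case: (apos _).
  have := lenA_areflE (aact z s) x'W; have := lenA_arefl_neq (aact z s) x'W.
  by rewrite pz (negPf nz) -/x'' /=; lia.
exists x''; rewrite e; split.
- apply: rt_trans hx'; apply: rt_step; apply/bru_stepP.
  by exists (aact z s) => //; rewrite /x'' mulWt_areflK.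
(* [x''] is shorter than [x'] and [x2] is longer than [z] by one, so subadditivity is tight. *)
- by have := lenA_mul_le x''W x2W; rewrite e lx'; lia.
- by move=> x1' x2' h1 h2; have := ubound _ _ h1 h2; rewrite /bup ltnNge down.
Qed.

(** The level of the reflected root is the lowest positive one. It removes the [two_rho] term, so
    [Lsum] drops by exactly 1, and [ell_aff > 0] says that [x] makes this root negative. *)
Lemma arefl_down x v a : x.1 \in W -> LP x v -> pos a -> delta v a = 1 ->
  0 < ell_aff x (wact v a) ->
  let z := mulWt x (arefl (wact v a, (~~ pos (wact v a))%:Z)) in
  [/\ bru z x, lenA x = (lenA z).+1 & LP z (v * srefl a)%g].
Proof.
move=> xW hv pa da la z; have [vW hL] := (LP_Lsum v xW).1 hv.
set b := (wact v a, _) in z *.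
have zW : z.1 \in W by rewrite mulWt_arefl_W.
have vaW := mul_srefl_W a vW.
have hLz : (lenA x)%:Z - 1 <= Lsum z (v * srefl a)%g.
  by rewrite /z /b Lsum_arefl_srefl // da subrr mulr0 addr0 lerD2r.
have lt : (lenA z < lenA x)%N.
  have := lenA_areflE b xW; have := lenA_arefl_neq b xW; rewrite -/z.
  rewrite [apos b]/apos /b /= lexx /apos /aact /=.
  by move: la; rewrite ell_affE; case: (pos (wact v a)); case: (pos _) => /=; lia.
have h := Lsum_le zW vaW.
split; [|by lia|by apply/LP_Lsum => //; split=> //; lia].
apply: rt_step; apply/bru_stepP; exists b => //.
by rewrite /z mulWt_areflK.
Qed.

(* If some step of the path has [ell_aff = 0], then [LP_edge0] and [bruC_LP]
   give a shorter path to [u'] from an element of [LP x1]. *)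
Lemma qb_path_descent x1 z u p u' : x1.1 \in W -> bru z x1 -> LP z u -> qb_path u p u' ->
  (forall v q, LP x1 v -> qb_path v q u' -> (lenA x1 + size p <= lenA z + size q)%N) ->
  exists z', [/\ bru z' x1, LP z' u', (lenA z' + size p = lenA z)%N,
    (z'.1 * u' = z.1 * u)%g & wactX u'^-1%g z'.2 = wactX u^-1%g z.2 - pwt u p].
Proof.
move=> x1W; elim: p z u => [|w p IH] z u hz hu /=.
  by move=> <- _; exists z; rewrite addn0 subr0.
case=> he hp hmin; have zW : z.1 \in W by rewrite (bru_W hz).
have [uW hl] := hu; have /(qb_edgeP _ uW) [a [pa ew da]] := he.
have := hl a pa; rewrite le_eqVlt => /orP [/eqP l0|lpos].
  have hw : LP z w by rewrite ew; apply: LP_edge0.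
  have [v [q [hv hq sq]]] := bruC_LP (bru_bruC zW hz) hw.
  have := hmin v (q ++ p) hv (qb_path_cat hq hp); rewrite size_cat; lia.
have [] := arefl_down zW hu pa da lpos; set k := (~~ _)%:Z; set z2 := mulWt _ _ => hz2 l2 hw2.
rewrite -ew in hw2.
have [||z' [h1 h2 h3 h4 h5]] := IH z2 w _ hw2 hp.
- exact: rt_trans hz2 hz.
- by move=> v q hv hq; have := hmin v q hv hq; lia.
have [f1 f2] := arefl_frame z a k uW; rewrite -/z2 in f1 f2.
exists z'; split=> //; first by lia.
  by rewrite h4 ew mulgA f1 -mulgA srefl2 mulg1.
have z2W : z2.1 \in W by rewrite mulWt_arefl_W.
rewrite h5 {1}ew invMg sreflV wactXM ?srefl_W ?groupV // f2 wactX_srefl.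
rewrite reflXD reflXK reflXMz reflX_cor mulNrz opprD addrA; congr (_ - _ - _).
(* The level [k] is 1 exactly on quantum edges, so [cor a *~ k] is the weight of the edge. *)
by rewrite ew qb_wtE // /k; case: (pos _).
Qed.

End RootDatum.

Theorem theorem5p8 (D : rootDatum) (w1 w2 : {perm 'I_(rd_N D)})
  (mu1 mu2 : rd_X D) (v1 v2 : {perm 'I_(rd_N D)}) :
  w1 \in Wgrp D -> w2 \in Wgrp D ->
  LP (w1, mu1) v1 -> LP (w2, mu2) v2 ->
  (forall v1' v2', LP (w1, mu1) v1' -> LP (w2, mu2) v2' ->
     (dQB v1 (w2 * v2)%g <= dQB v1' (w2 * v2')%g)%N) ->
  let y : Wt D := ((w1 * v1 * v2^-1)%g,
                   wactX (v2 * v1^-1)%g mu1 + mu2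
                   - wactX v2 (wtQB v1 (w2 * v2)%g)) in
  is_demazure (w1, mu1) (w2, mu2) y /\
  (lenA y + dQB v1 (w2 * v2)%g = lenA (w1, mu1) + lenA (w2, mu2))%N /\
  LP y v2.
Proof.
move=> w1W w2W hv1 hv2 hmin y.
have [v1W _] := hv1; have [v2W _] := hv2; have uW := mul_W w2W v2W.
set x1 : Wt D := (w1, mu1) in hv1 hmin *; set x2 : Wt D := (w2, mu2) in hv2 hmin *.
have [x1W x2W] : x1.1 \in Wgrp D /\ x2.1 \in Wgrp D by [].
have [p [hp sp ep]] := wtQB_spec v1W uW.
have [|z [hz hu lz ez1 ez2]] := qb_path_descent x1W (rt_refl _ _ x1) hv1 hp.
  move=> v q hv hq; have [vW _] := hv; rewrite leq_add2l sp.
  by apply: leq_trans (hmin v v2 hv hv2) _; apply: (dQB_spec vW uW).2.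
have zW : z.1 \in Wgrp D by rewrite (bru_W hz).
have ey : y = mulWt z x2.
  rewrite /mulWt /y /=; congr (_, _).
    by apply: (mulIg v2); rewrite mulgKV -mulgA -ez1.
  have -> : z.2 = wactX (w2 * v2)%g (wactX v1^-1%g mu1 - wtQB v1 (w2 * v2)%g).
    by rewrite ep -ez2 wactXKV.
  rewrite [wactX (w2 * v2)%g _]wactXM // wactXK // wactXD // wactXN //.
  by rewrite wactXM ?groupV // addrAC.
have [ly hy] := lenA_mul_LP zW x2W hv2 hu.
rewrite -ey in ly hy.
have ld : (lenA y + dQB v1 (w2 * v2)%g = lenA x1 + lenA x2)%N by lia.
split; last by [].
have [x' [hx' lx' hmax]] := demazure_exists x1W x2W.
have x'W : x'.1 \in Wgrp D by rewrite (bru_W hx').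
have [v hv hwv] := lenA_mul_eq x'W x2W lx'.
have [v0 [q [hv0 hq sq]]] := bruC_LP (bru_bruC x'W hx') hwv.
have [[v0W _] [vW _]] := (hv0, hv).
have dq : (dQB v1 (w2 * v2)%g <= size q)%N.
  apply: leq_trans (hmin _ _ hv0 hv) _.
  exact: (dQB_spec v0W (mul_W w2W vW)).2.
(* [y] lies below the maximum, whose length is at most that of [y] by [sq] and [dq]. *)
have ym : y = mulWt x' x2.
  have [|//|] := bru_len (_ : bru y (mulWt x' x2)); last by lia.
  by rewrite ey; apply: hmax => //; apply: rt_refl.
split; first by exists z, x2; split=> //; split=> //; apply: rt_refl.
by rewrite ym.
Qed.
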